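(* For all $r_0, r_d, d \in \mathbb{Z}_{>0}$ and all integers $s \geq r_0(d r_d + 1) + r_d + 1$, letting $\mathbf{r}$ denote the $(d+1)$-tuple $\mathbf{r} = (r_0, 0, 0, \dotsc, 0, r_d)$, the following holds for all integers $a$ sufficiently large: with $T = T^a_{\mathbf{r}}$, \[ \mathrm{ex}_\Pi\big(n, s, \Sigma_{T}(s)\big) = \Pi_{T}(n)^{1+o(1)}, \] where $o(1)\to 0$ as $n\to\infty$.
   Context: A multigraph $G=(V,w)$ is a finite vertex set $V$ together with $w\colon\binom{V}{2}\to\mathbb{Z}_{\ge0}$. For $X\subseteq V$, $e(X)=\sum_{uv\in\binom X2}w(uv)$, $P(X)=\prod_{uv\in\binom X2}w(uv)$, $e(G)=e(V)$, $P(G)=P(V)$. $G$ is an $(s,q)$-graph if $e(X)\le q$ for every $s$-set $X\subseteq V$. $\mathrm{ex}_\Pi(n,s,q)$ is the maximum of $P(G)$ over $(s,q)$-graphs $G$ on vertex set $[n]$. A pattern $P$ on a finite set $V(P)$ assigns non-negative integer multiplicities $P(\{v\})$ to vertices (loops) and $P(\{u,v\})$ to pairs. A blow-up of $P$ on $[n]$ is a multigraph on $[n]$ with a map $f\colon[n]\to V(P)$ (not necessarily surjective) such that $w(vv')=P(\{f(v),f(v')\})$ for all distinct $v,v'$ (a loop multiplicity if $f(v)=f(v')$). $\Sigma_P(n)$ and $\Pi_P(n)$ are the maximum of $e(G)$ and of $P(G)$, respectively, over blow-ups $G$ of $P$ on $[n]$. Generalised Turán pattern: for a $(d+1)$-tuple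 $\mathbf{r}=(r_0,\dots,r_d)$ of non-negative integers with $r_0,r_d>0$ and integer $a$, with $R=\sum_ir_i$, $T^a_{\mathbf{r}}$ is the pattern on $[R]$ where for $v$ with $\sum_{i<j}r_i<v\le\sum_{i\le j}r_i$ the loop at $v$ has multiplicity $a-j$ and each pair $\{v,v'\}$ with $v<v'\le R$ has multiplicity $a-j+1$. *)

(* Defs.v *)
From mathcomp Require Import all_boot all_classical.

Set Implicit Arguments.
Unset Strict Implicit.
Unset Printing Implicit Defensive.

Local Open Scope nat_scope.
Local Open Scope set_scope.

(* The multiplicity function w.  Only its values at the 2-element subsets of V
   are ever used; the other values are irrelevant. *)
Definition multigraph (V : finType) := {set V} -> nat.

(* The pair {u, v} (u != v) has multiplicity P [set u; v] and the loop at v has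
   multiplicity P [set v]; the other values are irrelevant. *)
Definition pattern (V : finType) := {set V} -> nat.

Section Multigraph.
Variable V : finType.
Implicit Types (G : multigraph V) (X : {set V}).

Definition edge_sum_in G X : nat :=
  \sum_(uv : {set V} | (uv \subset X) && (#|uv| == 2)) G uv.

Definition edge_prod_in G X : nat :=
  \prod_(uv : {set V} | (uv \subset X) && (#|uv| == 2)) G uv.

Definition edge_sum G : nat := edge_sum_in G [set: V].

Definition edge_prod G : nat := edge_prod_in G [set: V].

Definition sq_graph (s q : nat) G : Prop :=
  forall X, #|X| = s -> edge_sum_in G X <= q.

End Multigraph.

(* The maximum of a set of natural numbers; junk value 0 if it has none. *)
Definition max_set (A : set nat) : nat :=
  xget 0 (fun m => A m /\ forall k, A k -> k <= m).

(* The maximum exists as soon as 2 <= s <= n.  For n < s the condition on G is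
   vacuous, so for n >= 2 there is no maximum and the value is the junk 0. *)
Definition ex_Pi (n s q : nat) : nat :=
  max_set (fun m => exists G : multigraph 'I_n, sq_graph s q G /\ edge_prod G = m).

Section Blowup.
Variables (V : finType) (P : pattern V).

Definition blowup (n : nat) (f : {ffun 'I_n -> V}) : multigraph 'I_n :=
  fun uv => P (f @: uv).

(* If f u = f v then [set f u; f v] = [set f u], the loop at f u. *)
Lemma blowupE (n : nat) (f : {ffun 'I_n -> V}) (u v : 'I_n) :
  blowup f [set u; v] = P [set f u; f v].
Proof. by rewrite /blowup imsetU !imset_set1. Qed.

Definition Sigma_pat (n : nat) : nat :=
  \max_(f : {ffun 'I_n -> V}) edge_sum (blowup f).

Definition Pi_pat (n : nat) : nat :=
  \max_(f : {ffun 'I_n -> V}) edge_prod (blowup f).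

End Blowup.

Section Turan.
Variables (r : seq nat) (a : nat).

(* The j such that vertex v lies in the j-th block of sizes r; vertices are
   numbered from 0, whence the shifted inequalities in turan_blockP. *)
Definition turan_block (v : 'I_(sumn r)) : nat := reshape_index r v.

(* The enumeration of a set of ordinals is increasing, so v < v' in the second
   case.  The subtraction is the true one provided size r <= a.+1. *)
Definition turan_pattern : pattern 'I_(sumn r) := fun e =>
  match enum e with
  | [:: v] => a - turan_block v
  | [:: v; _] => a - turan_block v + 1
  | _ => 0
  end.

Lemma turan_blockP (v : 'I_(sumn r)) (j : nat) : j < size r ->
  reflect (turan_block v = j)
          (sumn (take j r) <= v < sumn (take j.+1 r)).
Proof.
move=> jr; have tkS k : k < size r ->
    sumn (take k.+1 r) = sumn (take k r) + nth 0 r k.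
  by move=> kr; rewrite (take_nth 0 kr) sumn_rcons.
apply: (iffP andP) => [[lo hi]|<-].
  have c : v - sumn (take j r) < nth 0 r j by rewrite ltn_subLR // -tkS.
  have := flatten_indexKl c.
  by rewrite /flatten_index subnKC.
have vr := ltn_ord v.
rewrite tkS ?reshape_indexP //.
have := reshape_offsetP vr; have := reshape_indexK r v.
rewrite /flatten_index /turan_block; move=> vE oP.
by split; [rewrite -[leqRHS]vE leq_addr | rewrite -[ltnLHS]vE ltn_add2l].
Qed.

Lemma turan_loop (v : 'I_(sumn r)) : turan_pattern [set v] = a - turan_block v.
Proof. by rewrite /turan_pattern enum_set1. Qed.

Lemma turan_pair (v v' : 'I_(sumn r)) : v < v' ->
  turan_pattern [set v; v'] = a - turan_block v + 1.
Proof.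
move=> vv'; rewrite /turan_pattern.
suff -> : enum [set v; v'] = [:: v; v'] by [].
apply: (inj_map val_inj); apply: (irr_sorted_eq ltn_trans ltnn).
- rewrite sorted_map {1}/enum_mem -enumT; apply: sorted_filter.
    by move=> x y z; apply: ltn_trans.
  by rewrite -sorted_map val_enum_ord iota_ltn_sorted.
- by rewrite /= vv'.
move=> x; apply/mapP/mapP => -[y yin ->]; exists y => //;
  by move: yin; rewrite mem_enum !inE.
Qed.

End Turan.

Arguments turan_pattern r a _ : clear implicits.

(* Main.v *)
(* Write p = d rd + 1, N = r0 p + rd, and let the deficit of a pair be a + 1
   minus its multiplicity. Any t vertices of a blow-up of T have total
   deficit at least E(t) = sum_(i < t) floor(p i / N). Call lam the common
   logarithmic degree of the vertices of T under its optimal weighting.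
   Choosing types greedily shows ln Pi_T(n) >= lam n(n-1)/2, and blow-ups of
   T are (s, Sigma_T(s))-graphs.

   For the upper bound, delete vertices one by one: it suffices that every
   set of n vertices of an (s, Sigma_T(s))-graph contains one whose
   logarithmic degree in the set is at most lam (n - 1) + O(1). By
   averaging, one is found in any bounded weighted list of vertices to which
   every other vertex sends a logarithmic degree of at most lam on average.
   Suppose that there is no such list. Then, a being large, some new vertex
   sends a deficit of at most p k / N to any given bounded list of length k.
   It follows that t-sets have deficit at least E(t) for all t <= s, and a
   greedy choice gives an N-set X with deficit exactly E(N). Every outside
   vertex sends deficit at least p to X, so vertices sending exactly p, even
   to boundedly many such N-sets at once, exist; exchanging vertices of X
   for these reveals r0 classes of p + 1 vertices with deficit 1 inside and
   0 between classes, and then rd further vertices with pairwise deficit d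
   and deficit 0 to the classes. Every other vertex sends at most lam on
   weighted average to these vertices: a contradiction. *)
Require Import Defs.
From mathcomp Require Import all_boot all_order all_algebra.
From mathcomp Require Import all_classical all_reals all_analysis.
From mathcomp Require Import zify ring lra.

Set Implicit Arguments.
Unset Strict Implicit.
Unset Printing Implicit Defensive.

(** * Sums along lists *)

Section SeqSums.
Variable T : eqType.
Implicit Types (l : seq T) (F : T -> nat).

Lemma sum_seq_const l k : \sum_(x <- l) k = k * size l.
Proof. by rewrite big_const_seq count_predT iter_addn_0. Qed.

Lemma leq_sum_const l F k :
  {in l, forall x, F x <= k} -> \sum_(x <- l) F x <= k * size l.
Proof.
by move=> Fk; rewrite -sum_seq_const big_seq [leqRHS]big_seq leq_sum.
Qed.

Lemma leq_const_sum l F k :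
  {in l, forall x, k <= F x} -> k * size l <= \sum_(x <- l) F x.
Proof.
by move=> kF; rewrite -sum_seq_const big_seq [leqRHS]big_seq leq_sum.
Qed.

Lemma sum_le_const_eq l F k :
  {in l, forall x, k <= F x} -> \sum_(x <- l) F x <= k * size l ->
  {in l, forall x, F x = k}.
Proof.
elim: l => // x l IHl kF; rewrite big_cons /= mulnS => sum_le y.
have kF_l : {in l, forall z, k <= F z}.
  by move=> z z_l; rewrite kF // inE z_l orbT.
have := leq_const_sum kF_l; have := kF x (mem_head _ _) => Fx_ge sum_ge.
by rewrite inE => /predU1P[->|/IHl->]//; lia.
Qed.

End SeqSums.

Lemma size_flatten_const (T : Type) (ls : seq (seq T)) k :
  all (fun l => size l == k) ls -> size (flatten ls) = size ls * k.
Proof.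
elim: ls => //= l ls IHls /andP[/eqP size_l /IHls size_ls].
by rewrite size_cat size_l size_ls mulSn.
Qed.

Lemma flatten_map_subseq (I V : eqType) (s : seq I) (L' L : I -> seq V) :
  (forall i, subseq (L' i) (L i)) ->
  subseq (flatten [seq L' i | i <- s]) (flatten [seq L i | i <- s]).
Proof. by move=> subL; elim: s => //= i s; apply: cat_subseq. Qed.

Lemma uniq_flatten_mem (T : eqType) (ls : seq (seq T)) l :
  uniq (flatten ls) -> l \in ls -> uniq l.
Proof.
elim: ls => //= k ls IHls; rewrite cat_uniq => /and3P[uniq_k _ /IHls uniq_l].
by rewrite inE => /predU1P[->|].
Qed.

Lemma uniq_flatten_fibers (I V : eqType) (f : V -> I) (s : seq I)
    (L : I -> seq V) : uniq s ->
    {in s, forall i, uniq (L i) /\ {in L i, forall x, f x = i}} ->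
  uniq (flatten [seq L i | i <- s]).
Proof.
elim: s => //= i s IHs /andP[i_s uniq_s] fiberL.
have [uniq_Li f_Li] := fiberL i (mem_head _ _).
rewrite cat_uniq uniq_Li IHs // => [|j j_s]; last first.
  by apply: fiberL; rewrite inE j_s orbT.
rewrite andbT; apply/hasPn => x /flatten_mapP[j j_s x_Lj].
have [_ f_Lj] := fiberL j (mem_behead (s := i :: s) j_s).
by apply: contra i_s => x_Li; rewrite -(f_Li x x_Li) (f_Lj x x_Lj).
Qed.

Definition degree (V : Type) (c : V -> V -> nat) (l : seq V) (v : V) : nat :=
  \sum_(u <- l) c u v.

Fixpoint pair_sum (V : Type) (c : V -> V -> nat) (l : seq V) : nat :=
  if l is x :: l' then degree c l' x + pair_sum c l' else 0.

Lemma pair_sum_map (V W : Type) (f : W -> V) (c : V -> V -> nat) (l : seq W) :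
  pair_sum c (map f l) = pair_sum (fun u v => c (f u) (f v)) l.
Proof. by elim: l => //= x l ->; rewrite /degree big_map. Qed.

Definition copies (V : Type) (k : nat) (l : seq V) : seq V :=
  flatten (nseq k l).

Lemma size_copies (V : Type) k (l : seq V) : size (copies k l) = k * size l.
Proof.
by rewrite (@size_flatten_const _ _ (size l)) ?size_nseq // all_nseq eqxx orbT.
Qed.

Lemma mem_copies (V : eqType) k (l : seq V) v :
  (v \in copies k l) = (0 < k) && (v \in l).
Proof.
elim: k => //= k IHk; rewrite /copies /= mem_cat IHk.
by case: (v \in l); rewrite ?andbF.
Qed.

Section PairSums.
Variables (V : eqType) (c : V -> V -> nat).

Lemma degree_cons x l v : degree c (x :: l) v = c x v + degree c l v.
Proof. exact: big_cons. Qed.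

Lemma degree_cat l1 l2 v :
  degree c (l1 ++ l2) v = degree c l1 v + degree c l2 v.
Proof. exact: big_cat. Qed.

Lemma degree_rem u l v : u \in l -> degree c l v = c u v + degree c (rem u l) v.
Proof. by move=> u_l; rewrite /degree (big_rem u u_l). Qed.

Lemma degree_flatten ls v :
  degree c (flatten ls) v = \sum_(l <- ls) degree c l v.
Proof. exact: big_flatten. Qed.

Lemma degree_copies k l v : degree c (copies k l) v = k * degree c l v.
Proof. by rewrite degree_flatten big_nseq iter_addn_0 mulnC. Qed.

Lemma degree_eq0P l v : reflect {in l, forall u, c u v = 0} (degree c l v == 0).
Proof.
rewrite /degree sum_nat_seq_eq0; apply: (iffP allP) => c0 u u_l.
  exact/eqP/(c0 u u_l).
by rewrite /= c0.
Qed.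

Lemma leq_degree_uniq l l' v : uniq l -> uniq l' -> {subset l <= l'} ->
  degree c l v <= degree c l' v.
Proof. exact: (uniq_sub_le_big leqnn (fun m n => leq_addr n m)). Qed.

Hypothesis cC : forall u v, c u v = c v u.

Lemma sum_degree l :
  \sum_(u <- l) degree c l u = 2 * pair_sum c l + \sum_(u <- l) c u u.
Proof.
elim: l => [|x l IHl]; first by rewrite !big_nil.
rewrite /= !big_cons degree_cons.
under [X in _ + X = _]eq_bigr do rewrite degree_cons.
rewrite big_split /= IHl.
have -> : \sum_(u <- l) c x u = degree c l x.
  by apply: eq_bigr => u _; rewrite cC.
lia.
Qed.

Lemma sum_degree_rem l : \sum_(u <- l) degree c (rem u l) u = 2 * pair_sum c l.
Proof.
apply: (@addIn (\sum_(u <- l) c u u)); rewrite -sum_degree -big_split /=.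
by apply: eq_big_seq => u /degree_rem->; rewrite addnC.
Qed.

Lemma pair_sum_perm l1 l2 : perm_eq l1 l2 -> pair_sum c l1 = pair_sum c l2.
Proof.
move=> perm_l; have := sum_degree l1; have := sum_degree l2.
rewrite !(perm_big _ perm_l) /=.
have -> : \sum_(u <- l2) degree c l1 u = \sum_(u <- l2) degree c l2 u.
  by apply: eq_bigr => u _; apply: perm_big.
lia.
Qed.

Lemma pair_sum_rem u l :
  u \in l -> pair_sum c l = degree c (rem u l) u + pair_sum c (rem u l).
Proof. by move=> /perm_to_rem/pair_sum_perm->. Qed.

Lemma pair_sum_cat l1 l2 : pair_sum c (l1 ++ l2) =
  pair_sum c l1 + pair_sum c l2 + \sum_(u <- l1) degree c l2 u.
Proof.
elim: l1 => [|x l1 IHl1] /=; first by rewrite big_nil addn0.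
by rewrite degree_cat IHl1 big_cons; lia.
Qed.

Lemma pair_sum_const l k : uniq l ->
  {in l &, forall x y, x != y -> c x y = k} ->
  pair_sum c l = k * 'C(size l, 2).
Proof.
elim: l => [|x l IHl] /= => [_ _|/andP[x_l uniq_l] ck]; first by rewrite muln0.
rewrite IHl // => [|y z y_l z_l]; last by apply: ck; rewrite inE ?y_l ?z_l orbT.
rewrite binS bin1 mulnDr addnC; congr (_ + _); rewrite -sum_seq_const.
apply: eq_big_seq => u u_l; apply: ck; rewrite ?mem_head ?inE ?u_l ?orbT //.
by apply: contraNneq x_l => <-.
Qed.

Definition unit_blocks (I : eqType) (s : seq I) (L : I -> seq V) : Prop :=
  uniq (flatten [seq L i | i <- s]) /\
  {in s &, forall i j, {in L i & L j, forall x y, x != y -> c x y = (i == j)}}.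

Lemma unit_blocks_subseq (I : eqType) (s : seq I) (L L' : I -> seq V) :
  (forall i, subseq (L' i) (L i)) -> unit_blocks s L -> unit_blocks s L'.
Proof.
move=> subL [uniq_L cL]; split.
  exact: subseq_uniq (flatten_map_subseq s subL) uniq_L.
move=> i j i_s j_s x y /(mem_subseq (subL i)) x_i /(mem_subseq (subL j)).
exact: cL.
Qed.

Lemma pair_sum_unit_blocks (I : eqType) (s : seq I) (L : I -> seq V) q :
    unit_blocks s L -> {in s, forall i, size (L i) = q} ->
  pair_sum c (flatten [seq L i | i <- s]) = size s * 'C(q, 2).
Proof.
elim: s => [|i s IHs] //= [uniq_L cL] size_L.
have sub_s j : j \in s -> j \in i :: s by rewrite inE orbC => ->.
move: uniq_L; rewrite /= cat_uniq => /and3P[uniq_Li /hasPn disj uniq_rest].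
rewrite pair_sum_cat // IHs => [|{}//|j /sub_s/size_L//]; last first.
  by split=> // j k /sub_s j_s /sub_s; apply: cL.
rewrite (pair_sum_const (k := 1)) // => [|x y x_i y_i xy]; last first.
  by rewrite (cL i i) ?mem_head ?eqxx.
rewrite size_L ?mem_head // mul1n mulSn big1_seq ?addn0 // => x /= x_i.
apply/eqP/degree_eq0P => y y_rest; have := disj y y_rest => /= y_i.
have [j j_s y_j] := flatten_mapP y_rest.
rewrite (cL j i) ?mem_head ?sub_s //; last by apply: contraNneq y_i => ->.
case: eqP => // ji; rewrite -ji y_j // in y_i.
Qed.

End PairSums.

(** * Sums of floors *)

Definition floor_sum (p N t : nat) : nat := \sum_(0 <= i < t) (p * i) %/ N.

Section FloorSum.
Variables p N : nat.

Lemma floor_sum0 : floor_sum p N 0 = 0.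
Proof. exact: big_geq. Qed.

Lemma floor_sumS t : floor_sum p N t.+1 = floor_sum p N t + (p * t) %/ N.
Proof. by rewrite /floor_sum big_nat_recr. Qed.

Lemma floor_sum_period : 0 < N -> floor_sum p N N.+1 = floor_sum p N N + p.
Proof. by move=> N_gt0; rewrite floor_sumS mulnK. Qed.

Lemma floor_sum_pred_period : 0 < p <= N ->
  floor_sum p N N = floor_sum p N N.-1 + p.-1.
Proof.
move=> /andP[p_gt0 pN]; rewrite -{2}(ltn_predK (leq_trans p_gt0 pN)) floor_sumS.
congr (_ + _); have -> : p * N.-1 = p.-1 * N + (N - p) by nia.
by rewrite divnMDl ?divn_small ?addn0; lia.
Qed.

(* The terms of index i and N - i add up to at least p - 1. *)
Lemma floor_sum_period_ge : 0 < N -> p.-1 * N.-1 <= 2 * floor_sum p N N.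
Proof.
move=> N_gt0.
have floor_sum1 : floor_sum p N N = \sum_(1 <= i < N) (p * i) %/ N.
  by rewrite /floor_sum big_ltn // muln0 div0n.
have -> : 2 * floor_sum p N N =
    \sum_(1 <= i < N) ((p * i) %/ N + (p * (N - i)) %/ N).
  rewrite mul2n -addnn big_split /= {1}floor_sum1 floor_sum1; congr (_ + _).
  by rewrite big_nat_rev; apply: eq_bigr => i _; rewrite add1n subSS.
rewrite mulnC -subn1 -sum_nat_const_nat !big_nat leq_sum // => i /andP[_ iN].
have := leq_divDl N (p * i) (p * (N - i)).
by rewrite -mulnDr subnKC ?(ltnW iN) // mulnK // addnC -leq_subLR subn1.
Qed.

Lemma floor_sum_addn_ge x k m : 0 < N -> m * N <= p * x ->
  floor_sum p N x + k * m <= floor_sum p N (x + k).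
Proof.
move=> N_gt0 mNpx; elim: k => [|k IHk]; first by rewrite mul0n !addn0.
rewrite addnS floor_sumS mulSn addnCA addnC leq_add // leq_divRL //.
by rewrite mulnDr (leq_trans mNpx) ?leq_addr.
Qed.

End FloorSum.

(** * Tight lists *)

(* In the blow-ups of T of maximal edge sum, the vertices of the first block
   of T weigh [class_size] times as much as those of its last block,
   asymptotically; [period] is the total weight. *)
Definition class_size (d rd : nat) : nat := (d * rd).+1.

Definition period (r0 rd d : nat) : nat := r0 * class_size d rd + rd.

Section Period.
Variables r0 rd d : nat.
Local Notation p := (class_size d rd).
Local Notation N := (period r0 rd d).

(* A window holds p + 1 vertices for each of at most N saturated vertices,
   one of N * N + 1 successive windows relates no new pair, and every vertex
   of the history they form gives at most N swaps. *)
Definition window_size : nat := N * p.+1.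

Definition history_bound : nat := (N * N).+1 * window_size.

Definition family_bound : nat := (history_bound * N).+1.

Definition search_bound : nat := (p * p).+1 * (N * family_bound) + p * N.

Lemma period_gt0 : 0 < rd -> 0 < N.
Proof. by rewrite /period addn_gt0 orbC => ->. Qed.

Hypotheses (r0_gt0 : 0 < r0) (rd_gt0 : 0 < rd).

Lemma class_size_lt_period : p < N.
Proof. by rewrite /period; nia. Qed.

Lemma pair_sum_period_le : r0 * 'C(p, 2) + d * 'C(rd, 2) <= floor_sum p N N.
Proof.
rewrite -(leq_pmul2l (isT : 0 < 2)).
apply: leq_trans (floor_sum_period_ge p (period_gt0 rd_gt0)).
have bin2E n : 2 * 'C(n, 2) = n * n.-1 by rewrite -mul_bin_diag bin1.
rewrite mulnDr !(mulnCA 2) !bin2E /period /class_size -(prednK rd_gt0) addnS /=.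
nia.
Qed.

Hypothesis d_gt0 : 0 < d.

Lemma floor_sum_layers_ge m : m <= d ->
  r0 * 'C(m, 2) <= floor_sum p N (r0 * m).+1.
Proof.
elim: m => [|m IHm] md; first by rewrite muln0.
have -> : (r0 * m.+1).+1 = (r0 * m).+1 + r0 by lia.
apply: leq_trans (floor_sum_addn_ge (m := m) r0 _ _).
- by rewrite binS bin1 mulnDr leq_add2r IHm // ltnW.
- exact: period_gt0.
- by rewrite /period /class_size; nia.
Qed.

Lemma floor_sum_two_after_layers_ge :
  r0 * 'C(d, 2) + d <= floor_sum p N (r0 * d).+2.
Proof.
rewrite floor_sumS leq_add ?floor_sum_layers_ge //.
by rewrite leq_divRL /period /class_size; nia.
Qed.

End Period.

Lemma copies_outweigh_slack p N k f D x q : p * f <= D -> p * q < k * N ->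
    N * (k * D + x) <= p * (k * (f * N) + q) ->
  D <= p * f /\ N * x <= p * q.
Proof.
move=> /subnKC <-; set e := D - p * f => slack.
have -> : N * (k * (p * f + e) + x) =
    p * (k * (f * N)) + (k * N * e + N * x) by lia.
rewrite mulnDr leq_add2l; have [->|e_gt0] := posnP e.
  by rewrite muln0 addn0.
move=> /(leq_trans (leq_addr _ _)).
by rewrite leqNgt (leq_trans slack) // leq_pmulr.
Qed.

Section TightLists.
Variables (V : eqType) (c : V -> V -> nat) (r0 rd d : nat).
Hypothesis cC : forall u v, c u v = c v u.
Hypotheses (r0_gt0 : 0 < r0) (rd_gt0 : 0 < rd).
Local Notation p := (class_size d rd).
Local Notation N := (period r0 rd d).
Local Notation E := (floor_sum p N).
Hypothesis pair_sum_ge :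
  forall l, uniq l -> size l <= N.+1 -> E (size l) <= pair_sum c l.

Let p_lt_N : p < N. Proof. exact: class_size_lt_period. Qed.
Let N_gt0 : 0 < N. Proof. exact: period_gt0. Qed.

Definition tight (Y : seq V) : bool :=
  [&& uniq Y, size Y == N & pair_sum c Y == E N].

Lemma tight_degree_ge Y v : tight Y -> v \notin Y -> p <= degree c Y v.
Proof.
case/and3P=> uniq_Y /eqP size_Y /eqP sum_Y v_Y.
have := pair_sum_ge (l := v :: Y).
rewrite /= v_Y uniq_Y size_Y sum_Y floor_sum_period // addnC leq_add2r.
exact.
Qed.

Hypothesis low_degree_exists : forall l, size l <= search_bound r0 rd d ->
  exists2 v, v \notin l & N * degree c l v <= p * size l.

Lemma tight_exists : exists X, tight X.
Proof.
have N_le : N <= search_bound r0 rd d.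
  by apply: leq_trans (leq_addl _ _); rewrite leq_pmull.
suff /(_ N (leqnn N))[X [uniq_X size_X sum_X]] : forall t, t <= N ->
    exists l, [/\ uniq l, size l = t & pair_sum c l <= E t].
  exists X; rewrite /tight uniq_X size_X eqxx eqn_leq sum_X /=.
  by have := pair_sum_ge uniq_X; rewrite size_X; apply.
elim=> [|t IHt] tN; first by exists [::].
have [l [uniq_l size_l sum_l]] := IHt (ltnW tN).
have [|v v_l deg_v] := low_degree_exists (l := l).
  by rewrite size_l (leq_trans (ltnW tN)).
exists (v :: l); rewrite /= v_l uniq_l size_l; split=> //.
by rewrite floor_sumS addnC leq_add // leq_divRL // mulnC -size_l.
Qed.

Lemma common_low_degree (F : seq (seq V)) (l : seq V) :
    size F <= family_bound r0 rd d -> {in F, forall Y, tight Y} ->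
    size l <= p * N ->
  exists v, [/\ v \notin flatten F, v \notin l,
    {in F, forall Y, degree c Y v = p} & N * degree c l v <= p * size l].
Proof.
move=> size_F tight_F size_l; set k := (p * p).+1.
have size_flF : size (flatten F) = size F * N.
  by apply: size_flatten_const; apply/allP => Y /tight_F/and3P[].
have [|v] := low_degree_exists (l := copies k (flatten F) ++ l).
  rewrite size_cat size_copies size_flF leq_add // leq_mul2l orFb.
  by rewrite mulnC leq_mul2l size_F orbT.
rewrite mem_cat mem_copies negb_or /= => /andP[v_F v_l].
rewrite degree_cat degree_copies size_cat size_copies size_flF.
have deg_ge : {in F, forall Y, p <= degree c Y v}.
  move=> Y Y_F; apply: tight_degree_ge (tight_F Y Y_F) _.
  by apply: contra v_F => v_Y; apply/flattenP; exists Y.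
have sum_ge := leq_const_sum deg_ge; rewrite -degree_flatten in sum_ge.
have slack : p * size l < k * N.
  apply: leq_ltn_trans (_ : p * (p * N) < _).
    by rewrite leq_mul2l size_l orbT.
  by rewrite mulnA ltn_pmul2r.
move=> /(copies_outweigh_slack sum_ge slack)[sum_le deg_l].
exists v; split=> //; apply: sum_le_const_eq deg_ge _.
by rewrite -degree_flatten.
Qed.

Definition homogeneous (I : eqType) (s : seq I) (L : I -> seq V) v : Prop :=
  {in s, forall i, {in L i &, forall x y, c x v = c y v}}.

Section SwapsOfTightList.
Variable X : seq V.
Hypothesis tight_X : tight X.

Let uniq_X : uniq X. Proof. by case/and3P: tight_X. Qed.
Let size_X : size X = N. Proof. by case/and3P: tight_X => _ /eqP. Qed.
Let sum_X : pair_sum c X = E N. Proof. by case/and3P: tight_X => _ _ /eqP. Qed.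

Definition saturated : seq V := [seq u <- X | degree c (rem u X) u == p.-1].

Lemma saturatedP u :
  reflect (u \in X /\ degree c (rem u X) u = p.-1) (u \in saturated).
Proof. by rewrite mem_filter andbC; apply: (iffP andP) => -[? /eqP]. Qed.

Lemma size_saturated_le : size saturated <= N.
Proof. by rewrite size_filter -size_X count_size. Qed.

Lemma tight_degree_rem_le u : u \in X -> degree c (rem u X) u <= p.-1.
Proof.
move=> u_X; have := pair_sum_ge (l := rem u X).
rewrite rem_uniq // size_rem // size_X => /(_ isT).
have := pair_sum_rem cC u_X.
by rewrite sum_X floor_sum_pred_period ?(ltnW p_lt_N) //; lia.
Qed.

Lemma size_saturated_gt : r0.-1 * p < size saturated.
Proof.
pose sat u := degree c (rem u X) u == p.-1.
have sum_le :
    \sum_(u <- X) degree c (rem u X) u + count (predC sat) X <= p.-1 * N.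
  rewrite -size_X -sum_seq_const -sum1_count [X in _ + X]big_mkcond.
  rewrite -big_split /= big_seq [leqRHS]big_seq.
  apply: leq_sum => u /tight_degree_rem_le.
  by rewrite /sat /=; case: eqP => /=; lia.
have := floor_sum_period_ge p N_gt0.
rewrite -sum_X -sum_degree_rem // => sum_ge.
have := count_predC sat X; rewrite size_X size_filter -/sat.
have : p.-1 * N = p.-1 * N.-1 + p.-1 by rewrite -mulnSr prednK.
have : N = r0.-1 * p + p + rd by rewrite /period -mulSnr prednK.
lia.
Qed.

Lemma tight_swap u v : u \in saturated -> v \notin X -> degree c X v = p ->
  c u v = 1 -> tight (v :: rem u X).
Proof.
case/saturatedP=> u_X deg_u v_X deg_v cuv.
rewrite /tight /= rem_uniq // size_rem // size_X prednK // eqxx.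
rewrite (contra (@mem_rem _ _ _ _)) //=.
have := pair_sum_rem cC u_X; have := degree_rem c v u_X.
rewrite sum_X deg_v deg_u; lia.
Qed.

Definition trace (v : V) : seq V := [seq u <- saturated | c u v == 1].

Lemma mem_trace u v : (u \in trace v) = (c u v == 1) && (u \in saturated).
Proof. exact: mem_filter. Qed.

Lemma trace_saturated v : {subset trace v <= saturated}.
Proof. by move=> u; rewrite mem_trace => /andP[]. Qed.

Lemma saturated_deficit u v :
  u \in saturated -> v \notin X -> degree c X v = p -> c u v = (u \in trace v).
Proof.
move=> u_sat v_X deg_v; rewrite mem_trace u_sat andbT.
have /saturatedP[u_X deg_u] := u_sat.
have := pair_sum_ge (l := v :: rem u X).
rewrite /= rem_uniq // size_rem // size_X prednK // leqnSn.
rewrite (contra (@mem_rem _ _ _ _)) // => /(_ isT isT).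
have := pair_sum_rem cC u_X; have := degree_rem c v u_X.
by rewrite sum_X deg_v deg_u; case: eqP; lia.
Qed.

Lemma size_trace_le v : v \notin X -> degree c X v = p -> size (trace v) <= p.
Proof.
move=> v_X deg_v; rewrite -deg_v -[size _]mul1n.
have sub_X : {subset trace v <= X}.
  by move=> u /trace_saturated/saturatedP[].
have uniq_trace : uniq (trace v) by rewrite !filter_uniq.
apply: leq_trans (leq_degree_uniq c v uniq_trace uniq_X sub_X).
by apply: leq_const_sum => u /[!mem_trace] /andP[/eqP->].
Qed.

(* Exchanging a vertex u of the trace of w for w in X gives another tight list,
   and a vertex sending exactly p to both lists cannot distinguish w from u. *)
Definition generic (h : seq V) (v : V) : Prop := [/\ v \notin X ++ h,
  degree c X v = p & {in h, forall w, {in trace w, forall u, c w v = c u v}}].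

Fixpoint generic_seq (h : seq V) : Prop :=
  if h is v :: h'
  then [/\ generic h' v, exists u, u \in trace v & generic_seq h'] else True.

Lemma generic_seq_mem h v : generic_seq h -> v \in h ->
  [/\ v \notin X, degree c X v = p & exists u, u \in trace v].
Proof.
elim: h => //= w h IHh [[+ deg_w _] w_trace /IHh h_mem].
by rewrite inE mem_cat negb_or => /andP[w_X _] /predU1P[->|/h_mem].
Qed.

Lemma generic_seq_uniq h : generic_seq h -> uniq h.
Proof.
elim: h => //= w h IHh [[+ _ _] _ /IHh->].
by rewrite mem_cat negb_or andbT => /andP[].
Qed.

Lemma generic_catr e h v : generic (e ++ h) v -> generic h v.
Proof.
case=> v_new deg_v twin_v; split=> // [|w w_h].
  by move: v_new; rewrite !mem_cat !negb_or => /and3P[-> _ ->].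
by apply: twin_v; rewrite mem_cat w_h orbT.
Qed.

Lemma generic_seq_cat_mem e h v : generic_seq (e ++ h) -> v \in e ->
  generic h v.
Proof.
elim: e => //= w e IHe [/generic_catr w_h _ /IHe e_h].
by rewrite inE => /predU1P[->|].
Qed.

Lemma generic_exists h l :
    generic_seq h -> size h <= history_bound r0 rd d -> size l <= p * N ->
  exists v, [/\ generic h v, v \notin l & N * degree c l v <= p * size l].
Proof.
move=> gen_h size_h size_l.
pose swaps := [seq w :: rem u X | w <- h, u <- trace w].
have swaps_tight : {in swaps, forall Y, tight Y}.
  move=> _ /allpairsPdep[w [u [w_h /[!mem_trace] /andP[/eqP cuw u_sat] ->]]].
  by have [w_X deg_w _] := generic_seq_mem gen_h w_h; apply: tight_swap.
have size_swaps : size swaps <= history_bound r0 rd d * N.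
  rewrite size_allpairs_dep sumnE big_map mulnC.
  apply: leq_trans (_ : N * size h <= _); last by rewrite leq_mul2l size_h orbT.
  apply: leq_sum_const => w w_h.
  have [w_X deg_w _] := generic_seq_mem gen_h w_h.
  exact: leq_trans (size_trace_le w_X deg_w) (ltnW p_lt_N).
have [|Y|//|v [v_F v_l deg_F deg_l]] :=
  common_low_degree (F := X :: swaps) (l := l).
- by rewrite ltnS.
- by rewrite inE => /predU1P[->|/swaps_tight].
have mem_F w u : w \in h -> u \in trace w -> w :: rem u X \in X :: swaps.
  move=> w_h u_w; rewrite inE orbC; apply/orP; left.
  by apply/allpairsPdep; exists w, u.
exists v; split=> //; split.
- move: (v_F); rewrite /= !mem_cat !negb_or => /andP[-> _] /=.
  apply: contra v_F => v_h; have [_ _ [u u_v]] := generic_seq_mem gen_h v_h.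
  by apply/flattenP; exists (v :: rem u X); rewrite ?mem_head ?mem_F.
- by rewrite deg_F ?mem_head.
- move=> w w_h u u_w; have := deg_F _ (mem_F w u w_h u_w); rewrite degree_cons.
  have /saturatedP[u_X _] := trace_saturated u_w.
  by have := deg_F X (mem_head _ _); rewrite (degree_rem c v u_X); lia.
Qed.

Lemma generic_hit h u :
    generic_seq h -> size h <= history_bound r0 rd d -> u \in saturated ->
  exists2 v, generic_seq (v :: h) & u \in trace v.
Proof.
move=> gen_h size_h u_sat; have /saturatedP[u_X _] := u_sat.
have size_rem_u : size (rem u X) = N.-1 by rewrite size_rem // size_X.
have [|v [gen_v _ deg_l]] := generic_exists (l := rem u X) gen_h size_h.
  by rewrite size_rem_u (leq_trans (leq_pred _)) // leq_pmull.
have [v_Xh deg_v _] := gen_v.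
have v_X : v \notin X by move: v_Xh; rewrite mem_cat negb_or => /andP[].
suff u_v : u \in trace v by exists v => //; split=> //; exists u.
have : degree c (rem u X) v < p.
  rewrite -(ltn_pmul2l N_gt0) (leq_ltn_trans deg_l) // size_rem_u mulnC.
  by rewrite ltn_pmul2r // ltn_predL.
have := degree_rem c v u_X; rewrite deg_v (saturated_deficit u_sat v_X deg_v).
by case: (u \in trace v) => //; lia.
Qed.

Lemma generic_hits h t :
    generic_seq h -> size h + size t <= history_bound r0 rd d ->
    {subset t <= saturated} ->
  exists e, [/\ size e = size t, generic_seq (e ++ h) &
    forall u, count_mem u t <= count (fun v => u \in trace v) e].
Proof.
move=> gen_h; elim: t => [|u t IHt] size_ht sub_t; first by exists [::].
have [||e [size_e gen_e count_e]] := IHt.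
- by apply: leq_trans size_ht; rewrite /= addnS.
- by move=> x x_t; rewrite sub_t // inE x_t orbT.
have [||v gen_v u_v] := @generic_hit (e ++ h) u gen_e.
- by rewrite size_cat size_e addnC (leq_trans _ size_ht) // /= addnS.
- by rewrite sub_t ?mem_head.
exists (v :: e); split=> //= [|x]; first by rewrite size_e.
by rewrite leq_add //; case: eqP => // <-; rewrite u_v.
Qed.

Definition related (h : seq V) (u u' : V) : bool :=
  has (fun w => (u \in trace w) && (u' \in trace w)) h.

Definition related_pairs (h : seq V) : seq (V * V) :=
  [seq x <- [seq (u, u') | u <- saturated, u' <- saturated]
  | related h x.1 x.2].

Lemma size_related_pairs_le h : size (related_pairs h) <= N * N.
Proof.
rewrite size_filter (leq_trans (count_size _ _)) // size_allpairs.
by rewrite leq_mul ?size_saturated_le.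
Qed.

Lemma related_catl e h u u' : related h u u' -> related (e ++ h) u u'.
Proof. by rewrite /related has_cat orbC => ->. Qed.

Lemma related_cat_stable e h :
    size (related_pairs (e ++ h)) <= size (related_pairs h) ->
  {in saturated &, forall u u', related (e ++ h) u u' = related h u u'}.
Proof.
move=> size_le u u' u_sat u'_sat.
have sub_pairs : subseq (related_pairs h) (related_pairs (e ++ h)).
  rewrite subseq_filter filter_subseq andbT; apply/allP => x.
  by rewrite mem_filter => /andP[/related_catl->].
have := size_subseq_leqif sub_pairs; rewrite /leqif eqn_leq size_le andbT.
move=> [-> /esym/eqP same_pairs].
have uu'_in : (u, u') \in [seq (x, y) | x <- saturated, y <- saturated].
  by apply/allpairsP; exists (u, u').
have := congr1 (fun s => (u, u') \in s) same_pairs.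
by rewrite /= !mem_filter uu'_in !andbT => <-.
Qed.

Lemma related_generic h v u u' :
  generic h v -> related h u u' -> c u v = c u' v.
Proof.
case=> _ _ twin_v /hasP[w w_h /andP[u_w u'_w]].
by rewrite -(twin_v w w_h u u_w) (twin_v w w_h u' u'_w).
Qed.

Lemma stable_window_exists : exists h e, [/\ generic_seq (e ++ h),
  size (e ++ h) <= history_bound r0 rd d,
  {in saturated, forall u, p < count (fun v => u \in trace v) e} &
  {in saturated &, forall u u', related (e ++ h) u u' = related h u u'}].
Proof.
pose reachable k := `[< exists h, [/\ generic_seq h,
  size h <= k * window_size r0 rd d & k <= size (related_pairs h)] >].
have reach0 : exists k, reachable k by exists 0; apply/asboolP; exists [::].
have reach_le k : reachable k -> k <= N * N.
  case/asboolP=> h [_ _ k_le].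
  exact: leq_trans k_le (size_related_pairs_le h).
case: (ex_maxnP reach0 reach_le) => k k_reach k_max.
have k_le := reach_le k k_reach.
have /asboolP[h [gen_h size_h k_related]] := k_reach.
have size_window : size (copies p.+1 saturated) <= window_size r0 rd d.
  by rewrite size_copies mulnC leq_mul2r size_saturated_le orbT.
have size_hw :
    size h + size (copies p.+1 saturated) <= k.+1 * window_size r0 rd d.
  by rewrite mulSn addnC leq_add.
have [||e [size_e gen_e count_e]] :=
  generic_hits (t := copies p.+1 saturated) gen_h.
- by rewrite (leq_trans size_hw) // leq_mul2r ltnS k_le orbT.
- by move=> u; rewrite mem_copies.
have size_eh : size (e ++ h) <= k.+1 * window_size r0 rd d.
  by rewrite size_cat size_e addnC.
exists h, e; split=> //.
- by rewrite (leq_trans size_eh) // leq_mul2r ltnS k_le orbT.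
- move=> u u_sat; apply: leq_trans (count_e u).
  rewrite /copies count_flatten map_nseq sumn_nseq leq_pmull //.
  by rewrite -has_count has_pred1.
apply: related_cat_stable; apply: leq_trans k_related.
rewrite leqNgt; apply/negP => k_lt.
suff /k_max : reachable k.+1 by rewrite ltnn.
by apply/asboolP; exists (e ++ h).
Qed.

Lemma generic_seq_pair h v w : generic_seq h -> v \in h -> w \in h -> v != w ->
  {in trace v, forall u, c v w = c u w} \/
  {in trace w, forall u, c w v = c u v}.
Proof.
elim: h => //= x h IHh [[_ _ twin_x] _ gen_h]; rewrite !inE.
move=> /predU1P[->|v_h] /predU1P[->|w_h]; first by rewrite eqxx.
- by right; apply: twin_x.
- by left; apply: twin_x.
- exact: IHh.
Qed.

Section StableWindow.
Variables h e : seq V.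
Hypothesis gen_eh : generic_seq (e ++ h).
Hypothesis stable :
  {in saturated &, forall u u', related (e ++ h) u u' = related h u u'}.

Let gen_e v : v \in e ->
  [/\ generic h v, v \notin X, degree c X v = p & exists u, u \in trace v].
Proof.
move=> v_e; have := generic_seq_cat_mem gen_eh v_e.
by case: (generic_seq_mem gen_eh (_ : v \in e ++ h)); rewrite ?mem_cat ?v_e.
Qed.

Lemma trace_eq v w u : v \in e -> w \in e -> u \in trace v -> u \in trace w ->
  trace v = trace w.
Proof.
move=> v_e w_e u_v u_w.
suff trace_sub x y : x \in e -> y \in e -> u \in trace x -> u \in trace y ->
    {subset trace x <= trace y}.
  apply: eq_in_filter => x x_sat; have := trace_sub _ _ v_e w_e u_v u_w x.
  have := trace_sub _ _ w_e v_e u_w u_v x; rewrite !mem_trace x_sat !andbT.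
  by move=> wv vw; apply/idP/idP.
move=> {v w v_e w_e u_v u_w} x_e y_e u_x u_y z z_x.
move: (z_x) (u_y); rewrite !mem_trace => /andP[_ z_sat] /andP[/eqP cuy u_sat].
have u_z : related h u z.
  by rewrite -stable //; apply/hasP; exists x; rewrite ?mem_cat ?x_e // u_x.
have [gen_y _ _ _] := gen_e y_e.
by rewrite z_sat andbT -(related_generic gen_y u_z) cuy.
Qed.

Lemma window_deficit v w : v \in e -> w \in e -> v != w ->
  c v w = (trace v == trace w).
Proof.
have one_sided x y : x \in e -> y \in e ->
    {in trace x, forall u, c x y = c u y} -> c x y = (trace x == trace y).
  move=> x_e y_e twin_x; have [_ _ _ [u u_x]] := gen_e x_e.
  have [_ y_X deg_y _] := gen_e y_e.
  rewrite (twin_x u u_x) (saturated_deficit (trace_saturated u_x) y_X deg_y).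
  by congr nat_of_bool; apply/idP/eqP => [/(trace_eq x_e y_e u_x)|<-].
move=> v_e w_e vw.
have [||twin_v|twin_w] := generic_seq_pair gen_eh _ _ vw.
- by rewrite mem_cat v_e.
- by rewrite mem_cat w_e.
- exact: one_sided.
- by rewrite cC eq_sym one_sided.
Qed.

Hypothesis window_hits :
  {in saturated, forall u, p < count (fun v => u \in trace v) e}.

Let traces := undup [seq trace v | v <- e].
Let trace_class t := take p.+1 [seq v <- e | trace v == t].

Lemma size_traces_ge : r0 <= size traces.
Proof.
have sat_sub : {subset saturated <= flatten traces}.
  move=> u u_sat; have : has (fun v => u \in trace v) e.
    by rewrite has_count (leq_ltn_trans _ (window_hits u_sat)).
  case/hasP=> v v_e u_v; apply/flattenP; exists (trace v) => //.
  by rewrite mem_undup map_f.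
have size_flat : size (flatten traces) <= p * size traces.
  rewrite size_flatten sumnE big_map leq_sum_const // => t.
  rewrite mem_undup => /mapP[v /gen_e[_ v_X deg_v _] ->].
  exact: size_trace_le.
have := leq_trans (uniq_leq_size (filter_uniq _ uniq_X) sat_sub) size_flat.
move=> /(leq_trans size_saturated_gt); rewrite mulnC ltn_pmul2l //.
by rewrite prednK.
Qed.

Lemma size_trace_class t : t \in traces -> size (trace_class t) = p.+1.
Proof.
rewrite mem_undup => /mapP[v v_e ->]; apply: size_takel; rewrite size_filter.
have [_ _ _ [u u_v]] := gen_e v_e.
apply: leq_trans (window_hits (trace_saturated u_v)) _.
apply/eq_leq/eq_in_count => w w_e /=.
by apply/idP/eqP => [u_w|->//]; apply: trace_eq u_w u_v.
Qed.

Lemma trace_classP t v : v \in trace_class t -> v \in e /\ trace v = t.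
Proof. by move=> /mem_take; rewrite mem_filter => /andP[/eqP]. Qed.

Lemma unit_blocks_trace_class s : uniq s -> unit_blocks c s trace_class.
Proof.
move=> uniq_s; split.
  apply: (uniq_flatten_fibers (f := trace)) => // t _; split.
    rewrite take_uniq // filter_uniq //.
    exact: subseq_uniq (prefix_subseq e h) (generic_seq_uniq gen_eh).
  by move=> v /trace_classP[].
move=> t t' _ _ v w /trace_classP[v_e trace_v] /trace_classP[w_e trace_w] vw.
by rewrite window_deficit // trace_v trace_w.
Qed.

End StableWindow.

Lemma classes_exist : exists (s : seq (seq V)) (L : seq V -> seq V), [/\
  unit_blocks c s L, size s = r0, {in s, forall t, size (L t) = p.+1} &
  forall l, size l <= p * N -> exists v,
    [/\ v \notin flatten [seq L t | t <- s], v \notin l, homogeneous s L v &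
      N * degree c l v <= p * size l]].
Proof.
have [h [e [gen_eh size_eh hits stable]]] := stable_window_exists.
exists (take r0 (undup [seq trace v | v <- e])).
exists (fun t => take p.+1 [seq v <- e | trace v == t]).
split.
- apply: unit_blocks_trace_class gen_eh stable _ _.
  by rewrite take_uniq ?undup_uniq.
- by rewrite size_takel // (size_traces_ge gen_eh hits).
- by move=> t /mem_take; apply: (size_trace_class gen_eh stable hits).
move=> l size_l.
have [v [gen_v v_l deg_l]] := generic_exists gen_eh size_eh size_l.
have [v_Xeh _ twin_v] := gen_v; exists v; split=> //.
  apply/flatten_mapP => -[t _ /trace_classP[v_e _]].
  by rewrite !mem_cat v_e orbT in v_Xeh.
move=> t _ x y /trace_classP[x_e trace_x] /trace_classP[y_e trace_y].
have mem_eh z : z \in e -> z \in e ++ h by rewrite mem_cat => ->.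
have [_ _ [u u_x]] := generic_seq_mem gen_eh (mem_eh x x_e).
by rewrite !(twin_v _ (mem_eh _ _) u) // trace_y -trace_x.
Qed.

End SwapsOfTightList.

Hypothesis d_gt0 : 0 < d.

Section FarVertices.
Variables (I : eqType) (s : seq I) (L : I -> seq V).
Hypotheses (blocks_L : unit_blocks c s L) (size_s : size s = r0)
  (size_L : {in s, forall i, size (L i) = p.+1}).
Local Notation A := (flatten [seq L i | i <- s]).

Definition far_set (W : seq V) : Prop := [/\ uniq W,
  {in W &, forall w w', w != w' -> c w w' = d} &
  {in W, forall w, w \notin A /\ degree c A w = 0}].

Lemma subclasses (L' : I -> seq V) q (B := flatten [seq L' i | i <- s]) :
    (forall i, subseq (L' i) (L i)) -> {in s, forall i, size (L' i) = q} ->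
  [/\ uniq B, size B = r0 * q, pair_sum c B = r0 * 'C(q, 2) & {subset B <= A}].
Proof.
move=> sub_L size_L'; have blocks_L' := unit_blocks_subseq sub_L blocks_L.
split; first by case: blocks_L'.
- rewrite (@size_flatten_const _ _ q) ?size_map ?size_s // all_map.
  by apply/allP => i /size_L' /= ->.
- by rewrite (pair_sum_unit_blocks blocks_L' size_L') size_s.
- exact/mem_subseq/flatten_map_subseq.
Qed.

Lemma size_take_class q : q <= p.+1 ->
  {in s, forall i, size (take q (L i)) = q}.
Proof. by move=> qp i i_s; rewrite size_takel // size_L. Qed.

Lemma degree_subclasses0 B v :
  {subset B <= A} -> degree c A v = 0 -> degree c B v = 0.
Proof.
move=> sub_BA /eqP/degree_eq0P cA0; apply/eqP/degree_eq0P => u /sub_BA.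
exact: cA0.
Qed.

Lemma far_deficit_ge v w : v \notin A -> w \notin A -> v != w ->
  degree c A v = 0 -> degree c A w = 0 -> d <= c w v.
Proof.
move=> v_A w_A vw degAv degAw.
have dp : d <= p.+1 by rewrite /class_size leqW // leqW // leq_pmulr.
have [] := subclasses (fun i => take_subseq (L i) d) (size_take_class dp).
set B := flatten _ => uniq_B size_B sum_B sub_BA.
have := @pair_sum_ge [:: v, w & B].
rewrite /= inE negb_or vw uniq_B size_B sum_B.
rewrite (contra (sub_BA v)) // (contra (sub_BA w)) //.
rewrite degree_cons !(degree_subclasses0 sub_BA) // addn0 add0n => /(_ isT).
move=> sum_ge; rewrite -(leq_add2l (r0 * 'C(d, 2))) [leqRHS]addnC.
apply: leq_trans (floor_sum_two_after_layers_ge r0_gt0 rd_gt0 d_gt0) (sum_ge _).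
by rewrite ltnS /period -addn1 leq_add // leq_mul2l leqW ?orbT // leq_pmulr.
Qed.

Lemma tight_core W (L' : I -> seq V) : far_set W -> size W = rd ->
    (forall i, subseq (L' i) (L i)) -> {in s, forall i, size (L' i) = p} ->
  tight (W ++ flatten [seq L' i | i <- s]).
Proof.
move=> [uniq_W cW W_A] size_W sub_L size_L'.
have [] := subclasses sub_L size_L'.
set B := flatten _ => uniq_B size_B sum_B sub_BA.
have size_WB : size (W ++ B) = N by rewrite size_cat size_W size_B addnC.
have uniq_WB : uniq (W ++ B).
  rewrite cat_uniq uniq_W uniq_B andbT; apply/hasPn => u /sub_BA u_A.
  by apply/negP => /= /W_A[]; rewrite u_A.
rewrite /tight uniq_WB size_WB eqxx eqn_leq /=; apply/andP; split.
  rewrite pair_sum_cat // (pair_sum_const uniq_W cW) size_W sum_B.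
  rewrite big1_seq => [|w /= /W_A[_]]; last exact: degree_subclasses0.
  by rewrite addn0 addnC pair_sum_period_le.
by have := pair_sum_ge uniq_WB; rewrite size_WB; apply.
Qed.

(* In either case the logarithmic degree of v to [A] and [W], weighted by
   [core_weight] below, does not exceed the rate. *)
Definition obstructed (A W : seq V) (v : V) : Prop :=
  p < degree c A v + degree c W v \/
  {in W, forall w, d <= c w v} /\ exists2 w, w \in W & d < c w v.

Lemma core_degree_ge W (L' : I -> seq V) v : far_set W -> size W = rd ->
    (forall i, subseq (L' i) (L i)) -> {in s, forall i, size (L' i) = p} ->
    v \notin A -> v \notin W ->
  p <= degree c (flatten [seq L' i | i <- s]) v + degree c W v.
Proof.
move=> far_W size_W sub_L size_L' v_A v_W.
have [_ _ _ sub_BA] := subclasses sub_L size_L'.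
have /(@tight_degree_ge _ v) := tight_core far_W size_W sub_L size_L'.
rewrite degree_cat addnC; apply; rewrite mem_cat negb_or v_W.
exact: contra (sub_BA v) v_A.
Qed.

Lemma detached_obstructed W v : far_set W -> size W = rd ->
  v \notin A -> v \notin W -> degree c A v = 0 -> obstructed A W v.
Proof.
move=> far_W size_W v_A v_W degA0; have [_ _ W_A] := far_W.
have cW : {in W, forall w, d <= c w v}.
  move=> w w_W; have [w_A degAw] := W_A w w_W.
  by apply: far_deficit_ge => //; apply: contraNneq v_W => ->.
right; split=> //; apply: contrapT => no_w.
have sub_L i := take_subseq (L i) p; have size_L' := size_take_class (leqnSn p).
have [_ _ _ sub_BA] := subclasses sub_L size_L'.
have := core_degree_ge far_W size_W sub_L size_L' v_A v_W.
rewrite (degree_subclasses0 sub_BA) // leqNgt ltnS -size_W => /negP[].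
apply: leq_sum_const => w w_W; rewrite leqNgt; apply/negP => d_lt.
by apply: no_w; exists w.
Qed.

(* Since [A] has a spare vertex in each class, [core_degree_ge] still
   applies when a vertex of positive deficit to v is left out of [A]. *)
Lemma attached_obstructed W v : far_set W -> size W = rd ->
  v \notin A -> v \notin W -> degree c A v != 0 -> obstructed A W v.
Proof.
move=> far_W size_W v_A v_W degA; left; have [uniq_A _] := blocks_L.
have [x x_A cxv] : exists2 x, x \in A & 0 < c x v.
  move: degA; rewrite /degree sum_nat_seq_eq0 -has_predC.
  by case/hasP=> x x_A /=; rewrite -lt0n; exists x.
pose L' i := take p (rem x (L i)).
have sub_rem i : subseq (L' i) (rem x (L i)) by apply: take_subseq.
have sub_L i : subseq (L' i) (L i) := subseq_trans (sub_rem i) (rem_subseq _ _).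
have size_L' : {in s, forall i, size (L' i) = p}.
  move=> i i_s; rewrite size_takel //; have := size_L i_s.
  by have [/size_rem->->|/rem_id->->] := boolP (x \in L i).
have [] := subclasses sub_L size_L'; set B := flatten _ => uniq_B _ _ sub_BA.
have x_B : x \notin B.
  apply/flatten_mapP => -[i i_s /(mem_subseq (sub_rem i))].
  by rewrite mem_rem_uniqF // (uniq_flatten_mem uniq_A) ?map_f.
apply: leq_ltn_trans (core_degree_ge far_W size_W sub_L size_L' v_A v_W) _.
rewrite ltn_add2r; apply: leq_trans (_ : degree c (x :: B) v <= _).
  by rewrite degree_cons -[ltnLHS]add0n ltn_add2r.
apply: leq_degree_uniq => //=; first by rewrite x_B.
by move=> u; rewrite inE => /predU1P[->|/sub_BA].
Qed.

Lemma core_obstructed W v : far_set W -> size W = rd ->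
  v \notin A -> v \notin W -> obstructed A W v.
Proof.
have [degA0|degA] := eqVneq (degree c A v) 0 => *.
  exact: detached_obstructed.
exact: attached_obstructed.
Qed.

Lemma homogeneous_degree0 v : homogeneous s L v ->
  degree c (flatten [seq take p (L i) | i <- s]) v < p -> degree c A v = 0.
Proof.
move=> homog_v deg_lt; have [uniq_A _] := blocks_L.
apply/eqP/degree_eq0P => x /flatten_mapP[i i_s x_i]; apply/eqP.
rewrite -leqn0 leqNgt; apply/negP => cxv.
move: deg_lt; rewrite ltnNge => /negP[].
have [uniq_B _ _ _] :=
  subclasses (fun i => take_subseq (L i) p) (size_take_class (leqnSn p)).
have sub_Li : {subset take p (L i) <= flatten [seq take p (L j) | j <- s]}.
  by move=> y y_i; apply/flatten_mapP; exists i.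
have uniq_Li : uniq (take p (L i)).
  by rewrite take_uniq // (uniq_flatten_mem uniq_A) ?map_f.
apply: leq_trans (leq_degree_uniq c v uniq_Li uniq_B sub_Li).
rewrite -{1}(size_take_class (leqnSn p) i_s) -[size _]mul1n.
by apply: leq_const_sum => y /mem_take y_i; rewrite (homog_v i i_s y x).
Qed.

Hypothesis homogeneous_exists : forall l, size l <= p * N -> exists v,
  [/\ v \notin A, v \notin l, homogeneous s L v &
    N * degree c l v <= p * size l].

Lemma far_vertex_exists W : far_set W -> size W < rd ->
  exists v, far_set (v :: W).
Proof.
move=> far_W size_W; have [uniq_W cW W_A] := far_W; set k := size W in size_W.
pose B := flatten [seq take p (L i) | i <- s].
have [uniq_B size_B _ sub_BA] :=
  subclasses (fun i => take_subseq (L i) p) (size_take_class (leqnSn p)).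
pose l := copies (k * d).+1 B ++ copies p W.
have size_l : size l = (k * d).+1 * (r0 * p) + p * k.
  by rewrite size_cat !size_copies size_B.
have [|v [v_A v_l homog_v deg_l]] := @homogeneous_exists l.
  rewrite size_l /period mulnDr; apply: leq_add.
    by rewrite leq_mul2r /class_size ltnS [k * d]mulnC leq_mul2l ltnW ?orbT.
  by rewrite leq_mul2l ltnW ?orbT.
have v_W : v \notin W.
  by move: v_l; rewrite mem_cat !mem_copies negb_or /= => /andP[].
have small_deg : (k * d).+1 * degree c B v + p * degree c W v < p * (k * d).+1.
  rewrite -!degree_copies -degree_cat -(ltn_pmul2l N_gt0).
  apply: leq_ltn_trans deg_l _; rewrite size_l [ltnRHS]mulnCA ltn_pmul2l //.
  rewrite /period mulnDl [_ * (r0 * p)]mulnC ltn_add2l /class_size.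
  by move: size_W; clear; lia.
have degA0 : degree c A v = 0.
  apply: homogeneous_degree0 homog_v _.
  rewrite -(ltn_pmul2l (ltn0Sn (k * d))) [ltnRHS]mulnC.
  exact: leq_ltn_trans (leq_addr _ _) small_deg.
have cW_ge : {in W, forall w, d <= c w v}.
  move=> w w_W; have [w_A degAw] := W_A w w_W.
  by apply: far_deficit_ge => //; apply: contraNneq v_W => ->.
have cWv : {in W, forall w, c w v = d}.
  apply: sum_le_const_eq cW_ge _.
  rewrite mulnC -ltnS -(ltn_pmul2l (isT : 0 < p)).
  exact: leq_ltn_trans (leq_addl _ _) small_deg.
exists v; split=> /=; first by rewrite v_W.
- move=> x y; rewrite !inE => /predU1P[->|x_W] /predU1P[->|y_W] xy.
  + by rewrite eqxx in xy.
  + by rewrite cC cWv.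
  + exact: cWv.
  + exact: cW.
- by move=> x; rewrite inE => /predU1P[->|/W_A].
Qed.

Lemma far_set_exists k : k <= rd -> exists2 W, far_set W & size W = k.
Proof.
elim: k => [|k IHk] k_le; first by exists [::].
have [W far_W size_W] := IHk (ltnW k_le).
have [|v far_vW] := far_vertex_exists far_W; first by rewrite size_W.
by exists (v :: W); rewrite /= ?size_W.
Qed.

End FarVertices.

Lemma core_exists : exists A W, [/\ size A = r0 * p.+1, size W = rd,
  {in W, forall w, w \notin A} &
  forall v, v \notin A -> v \notin W -> obstructed A W v].
Proof.
have [X tight_X] := tight_exists.
have [s [L [blocks_L size_s size_L homog]]] := classes_exist tight_X.
have [W far_W size_W] := far_set_exists blocks_L size_s size_L homog (leqnn rd).
exists (flatten [seq L t | t <- s]), W; split=> //.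
- by have [] := subclasses blocks_L size_s (fun i => subseq_refl (L i)) size_L.
- by case: far_W => _ _ W_A w /W_A[].
- by move=> v; apply: core_obstructed.
Qed.

End TightLists.

(** * Sums and products over the pairs of a set *)

Section BigPairs.
Variables (R : Type) (idx : R) (op : Monoid.com_law idx) (V : finType).
Variable F : {set V} -> R.

Lemma big_pairs0 :
  \big[op/idx]_(e : {set V} | (e \subset finset.set0) && (#|e| == 2)) F e = idx.
Proof.
apply: big_pred0 => e; rewrite finset.subset0.
by apply/andP => -[/eqP->]; rewrite cards0.
Qed.

Lemma big_pairsU1 (S : {set V}) v : v \notin S ->
  \big[op/idx]_(e : {set V} | (e \subset v |: S) && (#|e| == 2)) F e =
  op (\big[op/idx]_(u in S) F [set u; v])
     (\big[op/idx]_(e : {set V} | (e \subset S) && (#|e| == 2)) F e).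
Proof.
move=> v_S; rewrite (bigID (fun e : {set V} => v \in e)) /=.
congr (op _ _); last first.
  by apply: eq_bigl => e; rewrite andbAC -finset.subsetD1 finset.setU1K.
rewrite -(big_imset (h := fun u => [set u; v])) /=; last first.
  move=> x y x_S y_S /setP/(_ x).
  rewrite !inE eqxx => /esym/orP[/eqP//|/eqP x_v].
  by rewrite -x_v x_S in v_S.
apply: eq_bigl => e.
apply/andP/imsetP => [[/andP[sub_e card_e] v_e]|[u u_S ->]].
  have /cards1P[u e_u] : #|e :\ v| == 1 by rewrite (cardsD1 v) v_e in card_e.
  exists u; last by rewrite -(finset.setD1K v_e) e_u finset.setUC.
  by rewrite -finset.sub1set -e_u finset.subDset.
rewrite finset.subUset !finset.sub1set !inE u_S eqxx !orbT cards2.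
by rewrite (contraNneq _ v_S) // => <-.
Qed.

End BigPairs.

Section EdgeSum.
Variables (V : finType) (G : multigraph V).

Lemma edge_sum_in_seq (l : seq V) : uniq l ->
  edge_sum_in G [set x in l] = pair_sum (fun u v => G [set u; v]) l.
Proof.
elim: l => [|v l IHl] /= => [_|/andP[v_l uniq_l]].
  have -> : [set x in Nil V] = finset.set0 by apply/setP => x; rewrite !inE.
  exact: big_pairs0.
rewrite -IHl // finset.set_cons /edge_sum_in big_pairsU1 ?inE //; congr (_ + _).
by rewrite /degree (big_uniq _ uniq_l); apply: eq_bigl => u; rewrite inE.
Qed.

Lemma edge_sum_in_enum (S : {set V}) :
  edge_sum_in G S = pair_sum (fun u v => G [set u; v]) (enum S).
Proof. by rewrite -edge_sum_in_seq ?enum_uniq // finset.set_enum. Qed.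

End EdgeSum.

(** * Deficits of blow-ups *)

Section Fibers.
Variables (V : eqType) (T : finType) (f : V -> T) (P : pred T).

Lemma count_fibers l :
  count (fun u => P (f u)) l = \sum_(i | P i) count (fun u => f u == i) l.
Proof.
rewrite -sum1_count (partition_big f P) //=; apply: eq_bigr => i Pi.
rewrite -sum1_count; apply: eq_bigl => u.
by case: eqP => [->|_]; rewrite ?Pi ?andbF.
Qed.

Lemma fiber_pigeonhole l : 0 < #|P| ->
  exists2 i, P i &
    count (fun u => P (f u)) l <= #|P| * count (fun u => f u == i) l.
Proof.
move=> P_gt0; pose fiber i := count (fun u => f u == i) l.
have [i Pi max_i] := eq_bigmax_cond fiber P_gt0.
exists i => //; rewrite count_fibers -/(fiber i) -max_i -sum_nat_const.
by apply: leq_sum => j Pj; apply: (leq_bigmax_cond (P := P)).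
Qed.

End Fibers.

Section Defect.
Variables (r0 rd d : nat) (T : finType) (top : pred T).
Hypotheses (r0_gt0 : 0 < r0) (rd_gt0 : 0 < rd).
Hypotheses (card_top : #|top| = r0) (card_low : #|predC top| = rd).
Local Notation p := (class_size d rd).
Local Notation N := (period r0 rd d).

Definition defect (i j : T) : nat := (i == j) + d * (~~ top i && ~~ top j).

Lemma defectC i j : defect i j = defect j i.
Proof. by rewrite /defect eq_sym andbC. Qed.

Variables (V : eqType) (f : V -> T).
Local Notation c := (fun u v => defect (f u) (f v)).

Lemma degree_defect l v : degree c l v = count (fun u => f u == f v) l +
  d * ~~ top (f v) * count (fun u => ~~ top (f u)) l.
Proof.
elim: l => [|x l IHl]; first by rewrite /degree big_nil /= muln0.
rewrite degree_cons IHl /= /defect; case: (top (f x)); case: (top (f v)); lia.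
Qed.

Lemma degree_defect_rem l v : v \in l ->
  (1 + d * ~~ top (f v)) + degree c (rem v l) v =
    count (fun u => f u == f v) l +
    d * ~~ top (f v) * count (fun u => ~~ top (f u)) l.
Proof.
by move=> v_l; rewrite -degree_defect (degree_rem c v v_l) /defect eqxx andbb.
Qed.

Lemma top_or_low_large m t tops lows x y :
    m * N <= p * t -> tops + lows = t.+1 -> tops <= r0 * x -> lows <= rd * y ->
  m < x \/ 0 < lows /\ m < d * lows.-1 + y.
Proof.
move=> mN_le total tops_le lows_le; have [|x_le] := ltnP m x; [by left | right].
have tops_m : tops <= r0 * m.
  by rewrite (leq_trans tops_le) // leq_mul2l x_le orbT.
have lows_ge : rd * m + p <= p * lows.
  have : p * t.+1 <= p * (r0 * m) + p * lows.
    by rewrite -total mulnDr leq_add2r leq_mul2l tops_m orbT.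
  by move: mN_le; rewrite /period; clear; lia.
have lows_gt0 : 0 < lows by case: (lows) lows_ge => //; rewrite muln0 addnC.
split=> //; rewrite -(ltn_pmul2l rd_gt0) mulnDr.
move: lows_ge lows_le lows_gt0; rewrite /class_size.
by case: lows {total} => //= k; clear; lia.
Qed.

Lemma defect_large_degree l : 0 < size l ->
  exists2 v, v \in l & (p * (size l).-1) %/ N <= degree c (rem v l) v.
Proof.
move=> l_gt0; set m := _ %/ _.
have [|i top_i] := @fiber_pigeonhole _ _ f top l; first by rewrite card_top.
have [|j low_j] := @fiber_pigeonhole _ _ f (predC top) l.
  by rewrite card_low.
rewrite card_low card_top => lows_le tops_le.
have total := count_predC (fun u => top (f u)) l.
have fiber_mem k n :
    n < count (fun u => f u == k) l -> exists2 v, v \in l & f v = k.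
  move=> count_gt0; have : has (fun u => f u == k) l.
    by rewrite has_count (leq_ltn_trans _ count_gt0).
  by case/hasP=> v v_l /eqP f_v; exists v.
have mN_le : m * N <= p * (size l).-1 by apply: leq_divM.
rewrite -(prednK l_gt0) in total.
have [m_lt|[lows_gt0 m_lt]] := top_or_low_large mN_le total tops_le lows_le.
  have [v v_l f_v] := fiber_mem i m m_lt; exists v => //.
  by have := degree_defect_rem v_l; rewrite f_v [top i]top_i !muln0; lia.
have [|v v_l f_v] := fiber_mem j 0.
  by have := leq_trans lows_gt0 lows_le; rewrite muln_gt0 => /andP[].
exists v => //; have := degree_defect_rem v_l.
rewrite f_v (negPf low_j) /= muln1.
move: m_lt lows_gt0; case: (count (predC _) l) => //= k.
by rewrite mulnS; lia.
Qed.

Lemma pair_sum_defect_ge l : floor_sum p N (size l) <= pair_sum c l.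
Proof.
have [n] := ubnP (size l); elim: n l => // n IHn l size_l.
have [/size0nil->|l_gt0] := posnP (size l); first by rewrite floor_sum0.
have [v v_l deg_v] := defect_large_degree l_gt0.
have cC u w : c u w = c w u by apply: defectC.
rewrite (pair_sum_rem cC v_l) -(prednK l_gt0) floor_sumS addnC leq_add //.
by rewrite -(size_rem v_l) IHn // size_rem //; lia.
Qed.

End Defect.

Definition two_blocks (r0 rd d : nat) : seq nat := r0 :: rcons (nseq d.-1 0) rd.

Section TuranTwoBlocks.
Variables (r0 rd d a : nat).
Hypotheses (d_gt0 : 0 < d) (d_le_a : d <= a).
Local Notation r := (two_blocks r0 rd d).
Local Notation T := (turan_pattern r a).

Lemma sumn_two_blocks : sumn r = r0 + rd.
Proof. by rewrite /= sumn_rcons sumn_nseq mul0n. Qed.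

Definition in_top (i : 'I_(sumn r)) : bool := i < r0.

Lemma card_in_top : #|in_top| = r0.
Proof.
rewrite -sum1_card (eq_bigl (fun i : 'I_(sumn r) => i < r0)) //.
rewrite big_ord_narrow; first by rewrite sumn_two_blocks leq_addr.
by rewrite sum1_card card_ord.
Qed.

Lemma card_notin_top : #|predC in_top| = rd.
Proof.
by apply: (@addnI r0); rewrite -{1}card_in_top cardC card_ord sumn_two_blocks.
Qed.

Lemma turan_block_two_blocks i : turan_block i = d * ~~ in_top i.
Proof.
have size_r : size r = d.+1 by rewrite /= size_rcons size_nseq prednK.
have take_r : take d r = r0 :: nseq d.-1 0.
  rewrite -{1}(prednK d_gt0) /= -cats1 take_cat size_nseq ltnn subnn.
  by rewrite take0 cats0.
apply/turan_blockP.
  by rewrite size_r ltnS -[leqRHS]muln1 leq_mul2l leq_b1 orbT.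
have [top_i|low_i] := boolP (in_top i).
  by rewrite muln0 /= take0 /= addn0.
rewrite muln1 -size_r take_size ltn_ord andbT take_r /= sumn_nseq mul0n addn0.
by rewrite leqNgt.
Qed.

Lemma turan_two_blocks i j : T [set i; j] + defect d in_top i j = a.+1.
Proof.
wlog ij : i j / i <= j.
  move=> wl; case/orP: (leq_total i j) => /wl //.
  by rewrite finset.setUC defectC.
have [eq_ij|neq_ij] := eqVneq i j.
  rewrite eq_ij finset.setUid turan_loop turan_block_two_blocks.
  rewrite /defect eqxx andbb.
  by case: (in_top j) => /=; lia.
have ltn_ij : i < j by rewrite ltn_neqAle ij andbT.
rewrite turan_pair // turan_block_two_blocks /defect (negPf neq_ij).
have [top_i|low_i] := boolP (in_top i); first by rewrite /=; lia.
have -> : ~~ in_top j by move: low_i; rewrite /in_top; lia.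
by rewrite /=; lia.
Qed.

Lemma pair_sum_turan (V : eqType) (f : V -> 'I_(sumn r)) l :
  pair_sum (fun u v => T [set f u; f v]) l +
  pair_sum (fun u v => defect d in_top (f u) (f v)) l = a.+1 * 'C(size l, 2).
Proof.
elim: l => [|x l IHl] //=; first by rewrite muln0.
rewrite binS bin1 mulnDr -IHl addnACA addnC; congr (_ + _).
rewrite -big_split /= -sum_seq_const; apply: eq_bigr => u _.
exact: turan_two_blocks.
Qed.

Hypotheses (r0_gt0 : 0 < r0) (rd_gt0 : 0 < rd).

Lemma Sigma_turan_le s :
  Sigma_pat T s + floor_sum (class_size d rd) (period r0 rd d) s <=
    a.+1 * 'C(s, 2).
Proof.
have sumn_gt0 : 0 < sumn r by rewrite sumn_two_blocks addn_gt0 r0_gt0.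
have [|f Sigma_f] := eq_bigmax (fun f : {ffun 'I_s -> 'I_(sumn r)} =>
    edge_sum (blowup T f)).
  by apply/card_gt0P; exists [ffun=> Ordinal sumn_gt0].
have size_s : size (enum [set: 'I_s]) = s by rewrite -cardE cardsT card_ord.
rewrite /Sigma_pat Sigma_f /edge_sum edge_sum_in_enum.
rewrite -[X in 'C(X, 2)]size_s -(pair_sum_turan f).
have -> : (fun u v => blowup T f [set u; v]) = (fun u v => T [set f u; f v]).
  by apply/funext => u; apply/funext => v; apply: blowupE.
rewrite leq_add2l -{1}size_s.
by apply: pair_sum_defect_ge; rewrite ?card_in_top ?card_notin_top.
Qed.

End TuranTwoBlocks.

Lemma blowup_sq_graph (V : finType) (P : pattern V) n s (f : {ffun 'I_n -> V}) :
  sq_graph s (Sigma_pat P s) (blowup P f).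
Proof.
move=> X card_X; have size_X : size (enum X) == s by rewrite -cardE card_X.
pose g := tnth (Tuple size_X).
have -> : edge_sum_in (blowup P f) X = edge_sum (blowup P [ffun i => f (g i)]).
  rewrite /edge_sum !edge_sum_in_enum -(map_tnth_enum (Tuple size_X)).
  rewrite pair_sum_map enum_setT -enumT; congr (pair_sum _ _).
  by apply/funext => u; apply/funext => v; rewrite !blowupE !ffunE.
exact: (leq_bigmax_cond (F := fun F => edge_sum (blowup P F))).
Qed.

Import Order.TTheory GRing.Theory Num.Theory.
Local Open Scope ring_scope.

(** * The logarithmic density *)

Lemma ln_sub_ge (R : realType) (x y : R) :
  0 < x -> 0 < y -> (x - y) / x <= ln x - ln y.
Proof.
move=> x_gt0 y_gt0; have yx_gt0 : 0 < y / x by apply: divr_gt0.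
have := @le_ln1Dx R (y / x - 1); rewrite addrCA subrr addr0 => ln_le.
have {}ln_le : ln (y / x) <= y / x - 1 by apply: ln_le; lra.
rewrite ln_div ?posrE // in ln_le.
by rewrite mulrBl divff ?gt_eqF //; lra.
Qed.

Lemma sum_sub_le_ln (R : realType) (I : eqType) (s : seq I) (x : R)
    (F : I -> R) : 0 < x -> {in s, forall i, 0 < F i} ->
  \sum_(i <- s) (x - F i) <= x * \sum_(i <- s) (ln x - ln (F i)).
Proof.
move=> x_gt0 F_gt0; rewrite mulr_sumr big_seq [leRHS]big_seq.
apply: ler_sum => i i_s.
by rewrite mulrC -ler_pdivrMr // ln_sub_ge // F_gt0.
Qed.

Lemma ler_sum_exists (R : realDomainType) (I : eqType) (s : seq I)
    (y F G : I -> R) : s != [::] -> {in s, forall i, 0 < y i} ->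
    \sum_(i <- s) y i * F i <= \sum_(i <- s) y i * G i ->
  exists2 i, i \in s & F i <= G i.
Proof.
move=> s_neq0 y_gt0 sum_le; apply: contrapT => no_i.
have lt_G i : i \in s -> y i * G i < y i * F i.
  move=> i_s; rewrite ltr_pM2l ?y_gt0 // ltNge; apply/negP => F_le.
  by apply: no_i; exists i.
move: sum_le; rewrite leNgt => /negP[].
rewrite big_seq [ltRHS]big_seq ltr_sum //.
by case: s s_neq0 {y_gt0 no_i lt_G} => // i s _; rewrite /= mem_head.
Qed.

Section LogDeficit.
Variables (R : realType) (a : nat).
Implicit Types c : nat.

Definition log_deficit c : R := ln a.+1%:R - ln (a.+1 - c)%:R.

Lemma log_deficit0 : log_deficit 0 = 0.
Proof. by rewrite /log_deficit subn0 subrr. Qed.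

Lemma log_deficit_ge c : (c <= a)%N -> c%:R / a.+1%:R <= log_deficit c.
Proof.
move=> c_le; have := @ln_sub_ge R a.+1%:R (a.+1 - c)%:R.
rewrite !ltr0n subn_gt0 [(c < _)%N]c_le => /(_ isT isT).
by have -> : a.+1%:R - (a.+1 - c)%:R = c%:R :> R by rewrite natrB ?leqW //; lra.
Qed.

Lemma log_deficit_le c : (c <= a)%N -> log_deficit c <= c%:R / (a.+1 - c)%:R.
Proof.
move=> c_le; have := @ln_sub_ge R (a.+1 - c)%:R a.+1%:R.
rewrite !ltr0n subn_gt0 [(c < _)%N]c_le => /(_ isT isT).
have -> : (a.+1 - c)%:R - a.+1%:R = - c%:R :> R by rewrite natrB ?leqW //; lra.
by rewrite mulNr /log_deficit; lra.
Qed.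

Lemma log_deficit_mono c c' :
  (c <= c' <= a)%N -> log_deficit c <= log_deficit c'.
Proof.
move=> /andP[c_le c'_le].
rewrite lerD2l lerN2 ler_ln ?posrE ?ltr0n ?subn_gt0 ?ltnS //.
  by rewrite ler_nat leq_sub2l.
exact: leq_trans c'_le.
Qed.

Lemma log_deficit_superlinear c :
  (c <= a)%N -> c%:R * log_deficit 1 <= log_deficit c.
Proof.
elim: c => [|c IHc] c_lt; first by rewrite mul0r log_deficit0.
have {}IHc := IHc (ltnW c_lt).
suff : log_deficit 1 <= log_deficit c.+1 - log_deficit c.
  by rewrite -natr1 mulrDl mul1r; lra.
have pos n : (n <= a)%N -> (0 : R) < (a.+1 - n)%:R.
  by rewrite ltr0n subn_gt0 ltnS.
suff : ln (a.+1 - c.+1)%:R + ln a.+1%:R <=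
    ln (a.+1 - c)%:R + ln (a.+1 - 1)%:R :> R.
  by rewrite /log_deficit; lra.
rewrite -!lnM ?posrE ?pos ?ltr0n // ?(ltnW c_lt) ?(leq_trans _ c_lt) //.
rewrite ler_ln ?posrE ?mulr_gt0 ?pos ?(ltnW c_lt) ?(leq_trans _ c_lt) //.
by rewrite -!natrM ler_nat; nia.
Qed.

End LogDeficit.

Section LogRate.
Variables (R : realType) (r0 rd d a : nat).
Hypotheses (r0_gt0 : (0 < r0)%N) (rd_gt0 : (0 < rd)%N) (d_gt0 : (0 < d)%N).
Local Notation p := (class_size d rd).
Local Notation N := (period r0 rd d).

(* Up to a common factor, the weights of the vertices of the first and of
   the last block of T for which all vertices of T have the same logarithmic
   degree. *)
Definition top_weight : R :=
  rd.-1%:R * log_deficit R a d + log_deficit R a d.+1.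

Definition low_weight : R := log_deficit R a 1.

Definition log_loss : R :=
  low_weight * top_weight / (r0%:R * top_weight + rd%:R * low_weight).

Definition log_rate : R := ln a.+1%:R - log_loss.

Hypothesis d_lt_a : (d < a)%N.

Let a_gt0 : (0 < a)%N. Proof. exact: leq_ltn_trans d_lt_a. Qed.
Let gap_gt0 : (0 : R) < (a - d)%:R. Proof. by rewrite ltr0n subn_gt0. Qed.

Lemma low_weight_gt0 : 0 < low_weight.
Proof. by apply: lt_le_trans (log_deficit_ge R a_gt0); rewrite divr_gt0. Qed.

Lemma top_weight_gt0 : 0 < top_weight.
Proof.
apply: ltr_wpDl; last first.
  by apply: lt_le_trans (log_deficit_ge R d_lt_a); rewrite divr_gt0.
rewrite mulr_ge0 //.
by apply: le_trans (log_deficit_ge R (ltnW d_lt_a)); rewrite divr_ge0.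
Qed.

Lemma total_weight_gt0 : 0 < r0%:R * top_weight + rd%:R * low_weight.
Proof.
by rewrite addr_gt0 // mulr_gt0 ?low_weight_gt0 ?top_weight_gt0 ?ltr0n.
Qed.

Lemma log_lossE :
  log_loss * (r0%:R * top_weight + rd%:R * low_weight) =
  low_weight * top_weight.
Proof. by rewrite divfK // gt_eqF ?total_weight_gt0. Qed.

Lemma log_loss_le_low_weight : log_loss <= low_weight.
Proof.
rewrite ler_pdivrMr ?total_weight_gt0 // ler_wpM2l ?(ltW low_weight_gt0) //.
apply: ler_wpDr; first by rewrite mulr_ge0 // ltW ?low_weight_gt0.
by rewrite ler_peMl ?ler1n // ltW ?top_weight_gt0.
Qed.

Lemma log_rate_gt0 : (1 < a)%N -> 0 < log_rate.
Proof.
move=> a_gt1; have := log_loss_le_low_weight.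
rewrite /log_rate /low_weight /log_deficit subSS subn0.
have : 0 < ln a%:R :> R by rewrite ln_gt0 // ltr1n.
lra.
Qed.

Lemma low_weight_le : low_weight * (a - d)%:R <= 1.
Proof.
apply: le_trans (_ : 1%:R / a%:R * a%:R <= _); last first.
  by rewrite divfK // pnatr_eq0 -lt0n.
rewrite ler_pM ?ler_nat ?leq_subr ?(ltW low_weight_gt0) //.
by have := log_deficit_le R a_gt0; rewrite subSS subn0.
Qed.

Lemma top_weight_le : top_weight * (a - d)%:R <= p%:R.
Proof.
have log_deficit_d : log_deficit R a d * (a - d)%:R <= d%:R.
  apply: le_trans (ler_wpM2r (ltW gap_gt0) (log_deficit_le R (ltnW d_lt_a))) _.
  rewrite mulrAC ler_pdivrMr; last by rewrite ltr0n subn_gt0 ltnS ltnW.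
  by rewrite ler_wpM2l // ler_nat leq_sub2r.
have log_deficit_dS : log_deficit R a d.+1 * (a - d)%:R <= d.+1%:R.
  apply: le_trans (ler_wpM2r (ltW gap_gt0) (log_deficit_le R d_lt_a)) _.
  by rewrite subSS divfK // gt_eqF.
rewrite /top_weight mulrDl -mulrA.
apply: le_trans (lerD (ler_wpM2l (ler0n _ _) log_deficit_d) log_deficit_dS) _.
by rewrite -natrM -natrD ler_nat /class_size; clear -rd_gt0; nia.
Qed.

Lemma top_weight_le_low_weight :
  (p + d * p.+1 <= a)%N -> top_weight <= p.+1%:R * low_weight.
Proof.
move=> a_ge; have := top_weight_le; rewrite -ler_pdivlMr // => top_le.
apply: le_trans top_le _.
apply: le_trans (ler_wpM2l (ler0n _ _) (log_deficit_ge R a_gt0)).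
rewrite mulrA mulr1 ler_pdivrMr // mulrAC ler_pdivlMr ?ltr0n //.
by rewrite -!natrM ler_nat; move: a_ge d_lt_a; clear; nia.
Qed.

Lemma log_loss_le : N%:R * (a - d)%:R * log_loss <= p%:R.
Proof.
rewrite mulrA ler_pdivrMr ?total_weight_gt0 //.
have low_gt0 := low_weight_gt0; have top_gt0 := top_weight_gt0.
have top_part : r0%:R * p%:R * top_weight * (low_weight * (a - d)%:R) <=
    r0%:R * p%:R * top_weight * 1.
  by rewrite ler_wpM2l ?low_weight_le // !mulr_ge0 // ltW.
have low_part : rd%:R * low_weight * (top_weight * (a - d)%:R) <=
    rd%:R * low_weight * p%:R.
  by rewrite ler_wpM2l ?top_weight_le // !mulr_ge0 // ltW.
by rewrite natrD natrM; lra.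
Qed.

(* To first order, [log_loss] is [p / (N * a.+1)]. *)
Lemma log_loss_le_approx m : (0 < m)%N -> (p * d.+1 * m <= a - d)%N ->
  N%:R * a.+1%:R * log_loss <= p%:R + m%:R^-1.
Proof.
move=> m_gt0 m_le.
have -> : a.+1%:R = (a - d)%:R + d.+1%:R :> R.
  by rewrite -natrD; congr (_%:R); lia.
have loss_le : N%:R * log_loss <= p%:R / (a - d)%:R.
  by rewrite ler_pdivlMr // mulrAC log_loss_le.
rewrite mulrDr mulrDl lerD ?log_loss_le // mulrAC.
apply: le_trans (ler_wpM2r (ler0n _ _) loss_le) _.
rewrite mulrAC ler_pdivrMr // ler_pdivlMl ?ltr0n //.
by rewrite -!natrM ler_nat mulnC.
Qed.

End LogRate.

(** * A bounded light list *)

Definition list_bound (r0 rd d s : nat) : nat :=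
  (s + search_bound r0 rd d + (r0 * (class_size d rd).+1 + rd))%N.

Definition multiplicity_bound (r0 rd d s : nat) : nat :=
  (d + class_size d rd * d.+1 * list_bound r0 rd d s +
     (class_size d rd + d * (class_size d rd).+1)).+1.

Lemma multiplicity_boundP r0 rd d s a (p := class_size d rd) :
  (multiplicity_bound r0 rd d s <= a)%N ->
  [/\ d < a, p * d.+1 * list_bound r0 rd d s <= a - d & p + d * p.+1 <= a]%N.
Proof. by rewrite /multiplicity_bound -/p; split; lia. Qed.

Section LightList.
Variables (R : realType) (r0 rd d s a : nat).
Hypotheses (r0_gt0 : (0 < r0)%N) (rd_gt0 : (0 < rd)%N) (d_gt0 : (0 < d)%N).
Local Notation p := (class_size d rd).
Local Notation N := (period r0 rd d).
Local Notation m := (list_bound r0 rd d s).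
Local Notation rate := (log_rate R r0 rd d a).
Local Notation top := (top_weight R rd d a).
Local Notation low := (low_weight R a).
Hypotheses (N_lt_s : (N < s)%N) (a_ge : (multiplicity_bound r0 rd d s <= a)%N).

Let d_lt_a : (d < a)%N. Proof. by case: (multiplicity_boundP a_ge). Qed.
Let N_gt0 : (0 < N)%N. Proof. exact: period_gt0. Qed.
Let m_gt0 : (0 < m)%N. Proof. by rewrite /list_bound; lia. Qed.

Let low_gt0 : 0 < low. Proof. exact: low_weight_gt0 d_lt_a. Qed.
Let top_gt0 : 0 < top. Proof. exact: top_weight_gt0. Qed.

Variables (V : eqType) (w : V -> V -> nat).
Hypothesis wC : forall u v, w u v = w v u.
Hypothesis w_gt0 : forall u v, u != v -> (0 < w u v)%N.
Hypothesis pair_sum_sq : forall l, uniq l -> size l = s ->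
  (pair_sum w l + floor_sum p N s <= a.+1 * 'C(s, 2))%N.

Section Core.
Hypothesis w_le : forall u v, u != v -> (w u v <= a.+1)%N.

Definition deficit (u v : V) : nat := a.+1 - w u v.

Definition log_deficit_sum (l : seq V) (v : V) : R :=
  \sum_(u <- l) log_deficit R a (deficit u v).

Lemma deficitC u v : deficit u v = deficit v u.
Proof. by rewrite /deficit wC. Qed.

Lemma deficit_le u v : u != v -> (deficit u v <= a)%N.
Proof. by move=> /w_gt0; rewrite /deficit; lia. Qed.

Lemma degree_deficit l v : v \notin l ->
  (degree deficit l v + degree w l v = a.+1 * size l)%N.
Proof.
move=> v_l; rewrite -big_split /= -sum_seq_const; apply: eq_big_seq => u u_l.
by rewrite subnK // w_le //; apply: contraNneq v_l => <-.
Qed.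

Lemma pair_sum_deficit l : uniq l ->
  (pair_sum deficit l + pair_sum w l = a.+1 * 'C(size l, 2))%N.
Proof.
elim: l => [|v l IHl] /= => [_|/andP[v_l /IHl {}IHl]]; first by rewrite muln0.
by rewrite binS bin1 mulnDr -IHl addnACA degree_deficit // addnC.
Qed.

Lemma ln_multiplicity u v : u != v ->
  ln (w u v)%:R = ln a.+1%:R - log_deficit R a (deficit u v).
Proof. by move=> uv; rewrite /log_deficit opprB addrC subrK subKn ?w_le. Qed.

Lemma degree_deficit_le_log l v : v \notin l ->
  (degree deficit l v)%:R * low <= log_deficit_sum l v.
Proof.
move=> v_l; rewrite natr_sum mulr_suml big_seq [leRHS]big_seq.
apply: ler_sum => u u_l; rewrite log_deficit_superlinear // deficit_le //.
by apply: contraNneq v_l => <-.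
Qed.

Lemma log_deficit_sum_ge0 l v : v \notin l -> 0 <= log_deficit_sum l v.
Proof.
by move/degree_deficit_le_log; apply: le_trans; rewrite mulr_ge0 // ltW.
Qed.

Lemma log_deficit_sum_ge_top W v : size W = rd -> v \notin W ->
    {in W, forall u, (d <= deficit u v)%N} ->
    (exists2 u, u \in W & (d < deficit u v)%N) ->
  top <= log_deficit_sum W v.
Proof.
move=> size_W v_W deficit_ge [x x_W x_far].
have deficit_W u : u \in W -> (deficit u v <= a)%N.
  by move=> u_W; apply: deficit_le; apply: contraNneq v_W => <-.
rewrite /log_deficit_sum (big_rem x) //= /top_weight [leLHS]addrC lerD //.
  by rewrite log_deficit_mono // x_far deficit_W.
have <- : \sum_(u <- rem x W) log_deficit R a d = rd.-1%:R * log_deficit R a d.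
  by rewrite big_const_seq count_predT iter_addr_0 size_rem // size_W mulr_natl.
rewrite [leLHS]big_seq [leRHS]big_seq ler_sum // => u /mem_rem u_W.
by rewrite log_deficit_mono // deficit_ge // deficit_W.
Qed.

Lemma obstructed_log_deficit_ge A W v :
    size W = rd -> v \notin A -> v \notin W -> obstructed deficit rd d A W v ->
  top * low * p.+1%:R <=
    top * log_deficit_sum A v + p.+1%:R * low * log_deficit_sum W v.
Proof.
move=> size_W v_A v_W.
have pS_low_ge0 : 0 <= p.+1%:R * low.
  by rewrite mulr_ge0 // ltW.
case=> [deg_gt|[deficit_ge far_u]]; last first.
  apply: ler_wpDl; first by rewrite mulr_ge0 ?log_deficit_sum_ge0 // ltW.
  rewrite [leLHS]mulrC -mulrA ler_wpM2l //.
  rewrite [leLHS]mulrC ler_wpM2l ?(ltW low_gt0) //.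
  exact: log_deficit_sum_ge_top.
have top_le : top <= p.+1%:R * low.
  by case: (multiplicity_boundP a_ge) => *; apply: top_weight_le_low_weight.
apply: le_trans (_ : top * ((degree deficit A v)%:R * low) +
  p.+1%:R * low * ((degree deficit W v)%:R * low) <= _); last first.
  by rewrite lerD // ler_wpM2l ?degree_deficit_le_log // ltW.
apply: le_trans (_ : top * ((degree deficit A v)%:R * low) +
  top * ((degree deficit W v)%:R * low) <= _); last first.
  by rewrite lerD2l ler_wpM2r // mulr_ge0 // ltW.
rewrite -mulrDr -mulrDl -natrD [_ * low in leRHS]mulrC mulrA.
by rewrite ler_wpM2l ?ler_nat // mulr_ge0 // ltW.
Qed.

Lemma sum_ln_multiplicity l v : v \notin l ->
  \sum_(u <- l) ln (w u v)%:R = ln a.+1%:R * (size l)%:R - log_deficit_sum l v.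
Proof.
move=> v_l; rewrite mulr_natr -iter_addr_0 -count_predT -big_const_seq -sumrB.
apply: eq_big_seq => u u_l; rewrite ln_multiplicity //.
by apply: contraNneq v_l => <-.
Qed.

Definition core_weight (W : seq V) (u : V) : R :=
  if u \in W then p.+1%:R * low else top.

Lemma core_weight_gt0 W u : 0 < core_weight W u.
Proof. by rewrite /core_weight; case: ifP => // _; rewrite mulr_gt0. Qed.

Lemma sum_core_weight A W (F : V -> R) : {in W, forall u, u \notin A} ->
  \sum_(u <- A ++ W) core_weight W u * F u =
    top * \sum_(u <- A) F u + p.+1%:R * low * \sum_(u <- W) F u.
Proof.
move=> W_A; rewrite big_cat !mulr_sumr /=; congr (_ + _).
  apply: eq_big_seq => u u_A; rewrite /core_weight; case: ifP => // /W_A.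
  by rewrite u_A.
by apply: eq_big_seq => u u_W; rewrite /core_weight u_W.
Qed.

Lemma core_log_degree_le A W v : size A = (r0 * p.+1)%N -> size W = rd ->
    {in W, forall u, u \notin A} -> v \notin A -> v \notin W ->
    obstructed deficit rd d A W v ->
  \sum_(u <- A ++ W) core_weight W u * ln (w u v)%:R <=
    rate * \sum_(u <- A ++ W) core_weight W u.
Proof.
move=> size_A size_W W_A v_A v_W /(obstructed_log_deficit_ge size_W v_A v_W).
have -> : \sum_(u <- A ++ W) core_weight W u =
    p.+1%:R * (r0%:R * top + rd%:R * low).
  under eq_bigr do rewrite -[core_weight _ _]mulr1.
  rewrite sum_core_weight // !big_const_seq !count_predT !iter_addr_0.
  by rewrite size_A size_W natrM; ring.
rewrite sum_core_weight // !sum_ln_multiplicity // size_A size_W natrM.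
rewrite /rate mulrBl [log_loss _ _ _ _ _ * _]mulrCA log_lossE //.
lra.
Qed.

End Core.

Section Heavy.
Variable v0 : V.
Hypothesis heavy : forall (l : seq V) (y : V -> R), (0 < size l <= m)%N ->
  {in l, forall u, 0 < y u} -> exists2 v, v \notin l &
    rate * (\sum_(u <- l) y u) < \sum_(u <- l) y u * ln (w u v)%:R.

Lemma heavy_low_degree l : (size l <= m)%N -> exists2 v, v \notin l &
  (N * (a.+1 * size l) <= N * degree w l v + p * size l)%N.
Proof.
move=> size_l; have [/size0nil->|l_gt0] := posnP (size l).
  by exists v0; rewrite // !muln0.
have [||v v_l] := @heavy l (fun=> 1); rewrite ?l_gt0 //.
under [ltRHS]eq_bigr do rewrite mul1r.
rewrite big_const_seq count_predT iter_addr_0 => log_deg; exists v => //.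
have w_pos : {in l, forall u, 0 < (w u v)%:R :> R}.
  by move=> u u_l; rewrite ltr0n w_gt0 //; apply: contraNneq v_l => <-.
have := sum_sub_le_ln (ltr0Sn _ a) w_pos.
rewrite !sumrB !big_const_seq !count_predT !iter_addr_0 -natr_sum.
rewrite -/(degree w l v) -[_%:R *+ _]mulr_natr -[ln _ *+ _]mulr_natr => deg_le.
have size_gt0 : 0 < (size l)%:R :> R by rewrite ltr0n.
have size_m : (m%:R^-1 : R) * (size l)%:R <= 1.
  by rewrite mulrC ler_pdivrMr ?ltr0n // mul1r ler_nat.
have loss_le : N%:R * a.+1%:R * log_loss R r0 rd d a <= p%:R + m%:R^-1.
  by case: (multiplicity_boundP a_ge) => *; apply: log_loss_le_approx.
have deg_lt : a.+1%:R * (size l)%:R - (degree w l v)%:R <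
    a.+1%:R * (log_loss R r0 rd d a * (size l)%:R).
  apply: le_lt_trans deg_le _; rewrite ltr_pM2l ?ltr0n //.
  by move: log_deg; rewrite /log_rate; lra.
have loss_size := ler_wpM2r (ltW size_gt0) loss_le.
have deg_ltN : N%:R * (a.+1%:R * (size l)%:R - (degree w l v)%:R) <
    N%:R * (a.+1%:R * (log_loss R r0 rd d a * (size l)%:R)).
  by rewrite ltr_pM2l ?ltr0n.
rewrite -ltnS -(ltr_nat R) -[(_ + _).+1]addn1.
move: loss_size deg_ltN size_m; move: (N) (m) (p) => n k q.
by rewrite !natrD !natrM; lra.
Qed.

Lemma pair_sum_le l : uniq l -> (size l <= s)%N ->
  (pair_sum w l + floor_sum p N (size l) <= a.+1 * 'C(size l, 2))%N.
Proof.
move=> uniq_l size_l; have [k] := ubnP (s - size l).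
elim: k l uniq_l size_l => // k IHk l uniq_l size_l k_gt.
have [size_ls|size_ls] := eqVneq (size l) s.
  by rewrite size_ls pair_sum_sq.
have size_lt : (size l < s)%N by rewrite ltn_neqAle size_ls.
have [|v v_l deg_v] := @heavy_low_degree l.
  by rewrite (leq_trans size_l) // /list_bound -addnA leq_addr.
have k_ge : (s - (size l).+1 < k)%N by move: k_gt size_lt; clear; lia.
have := IHk (v :: l); rewrite /= v_l uniq_l => /(_ isT size_lt k_ge).
rewrite floor_sumS binS bin1 mulnDr => sum_le.
rewrite leqNgt; apply/negP => sum_gt; move: deg_v; rewrite leqNgt => /negP[].
apply: leq_trans (_ : N * (degree w l v + (p * size l %/ N).+1) <= _)%N.
  by rewrite mulnDr ltn_add2l [ltnRHS]mulnC ltn_ceil.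
rewrite leq_mul2l; apply/orP; right.
by move: sum_le sum_gt; move: (_ %/ _)%N => q; clear; lia.
Qed.

Lemma multiplicity_le u v : u != v -> (w u v <= a.+1)%N.
Proof.
move=> uv; have := @pair_sum_le [:: v; u]; rewrite /= inE eq_sym uv.
rewrite /degree big_nil big_cons big_nil !addn0 muln1 => sum_le.
apply: leq_trans (leq_addr _ _) (sum_le isT _).
by apply: leq_ltn_trans N_lt_s.
Qed.

Lemma not_heavy : False.
Proof.
have w_le := multiplicity_le.
have [||A [W [size_A size_W W_A core]]] :=
  core_exists deficitC r0_gt0 rd_gt0 _ _ d_gt0.
- move=> l uniq_l size_l; have := pair_sum_deficit w_le uniq_l.
  by have := pair_sum_le uniq_l (leq_trans size_l N_lt_s); lia.
- move=> l size_l; have [|v v_l deg_v] := @heavy_low_degree l.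
    by rewrite (leq_trans size_l) // /list_bound addnAC leq_addl.
  exists v => //; move: deg_v; rewrite -(degree_deficit w_le v_l) mulnDr.
  by rewrite [leqRHS]addnC leq_add2r.
have [||v] := @heavy (A ++ W) (core_weight W).
- by rewrite size_cat size_A size_W /list_bound leq_addl addn_gt0 rd_gt0 orbT.
- by move=> u _; apply: core_weight_gt0.
rewrite mem_cat negb_or => /andP[v_A v_W].
by rewrite ltNge core_log_degree_le //; apply: core.
Qed.

End Heavy.

Lemma light_list_exists (v0 : V) : exists (l : seq V) (y : V -> R), [/\
  (0 < size l <= m)%N, {in l, forall u, 0 < y u} & forall v, v \notin l ->
    \sum_(u <- l) y u * ln (w u v)%:R <= rate * \sum_(u <- l) y u].
Proof.
apply: contrapT => no_light; apply: (not_heavy v0) => l y size_l y_gt0.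
apply: contrapT => no_v; apply: no_light; exists l, y; split=> // v v_l.
by rewrite leNgt; apply/negP => heavy_v; apply: no_v; exists v.
Qed.

End LightList.

(** * Logarithms of edge products *)

Definition positive_graph (V : finType) (G : multigraph V) : Prop :=
  forall e : {set V}, #|e| = 2 -> (0 < G e)%N.

Lemma ln_nat_ge0 (R : realType) n : 0 <= ln n%:R :> R.
Proof. by case: n => [|n]; [rewrite ln0 | rewrite ln_ge0 // ler1n]. Qed.

Section LogProduct.
Variables (R : realType) (V : finType) (G : multigraph V).
Implicit Types S : {set V}.
Hypothesis G_gt0 : positive_graph G.

Lemma edge_prod_in_gt0 S : (0 < edge_prod_in G S)%N.
Proof. by apply: prodn_cond_gt0 => e /andP[_ /eqP]; apply: G_gt0. Qed.

Lemma ln_prodn S (F : V -> nat) : {in S, forall u, 0 < F u}%N ->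
  ln (\prod_(u in S) F u)%:R = \sum_(u in S) ln (F u)%:R :> R.
Proof.
move=> F_gt0.
suff [] : (0 < \prod_(u in S) F u)%N /\
    ln (\prod_(u in S) F u)%:R = \sum_(u in S) ln (F u)%:R :> R by [].
apply: (big_ind2 (fun (x : nat) (y : R) => (0 < x)%N /\ ln x%:R = y)).
- by rewrite ln1.
- move=> x1 y1 x2 y2 [x1_gt0 <-] [x2_gt0 <-].
  by rewrite muln_gt0 x1_gt0 x2_gt0 natrM lnM ?posrE ?ltr0n.
- by move=> u u_S; rewrite F_gt0.
Qed.

Lemma ln_edge_prod_in0 : ln (edge_prod_in G finset.set0)%:R = 0 :> R.
Proof. by rewrite /edge_prod_in big_pairs0 ln1. Qed.

Lemma ln_edge_prod_inU1 S (v : V) : v \notin S ->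
  ln (edge_prod_in G (v |: S))%:R =
  \sum_(u in S) ln (G [set u; v])%:R + ln (edge_prod_in G S)%:R :> R.
Proof.
move=> v_S; have star_gt0 : {in S, forall u, 0 < G [set u; v]}%N.
  by move=> u u_S; rewrite G_gt0 // cards2 (contraNneq _ v_S) // => <-.
have star_prod_gt0 := prodn_cond_gt0 star_gt0.
rewrite {1}/edge_prod_in big_pairsU1 //= natrM.
by rewrite lnM ?posrE ?ltr0n ?edge_prod_in_gt0 // ln_prodn.
Qed.

End LogProduct.

Lemma superset_card (V : finType) (A : {set V}) k : (#|A| <= k <= #|V|)%N ->
  exists2 X : {set V}, A \subset X & #|X| = k.
Proof.
move=> /andP[A_le le_V].
have /card_geqP[l [uniq_l size_l l_A]] : (k - #|A| <= #|~: A|)%N.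
  by rewrite leq_subLR cardsC.
exists (A :|: [set x in l]); first exact: finset.subsetUl.
rewrite cardsU (_ : A :&: _ = finset.set0) ?cards0 ?subn0.
  by rewrite cardsE (card_uniqP uniq_l) size_l subnKC.
apply/setP => x; rewrite !inE; apply/negP => /andP[x_A /l_A].
by rewrite inE x_A.
Qed.

Section SqGraph.
Variables (V : finType) (G : multigraph V) (s q : nat).
Hypotheses (s_gt1 : (1 < s)%N) (s_le : (s <= #|V|)%N) (Gsq : sq_graph s q G).

Lemma sq_graph_le (e : {set V}) : #|e| = 2%N -> (G e <= q)%N.
Proof.
move=> card_e; have [|X sub_eX card_X] := @superset_card V e s.
  by rewrite card_e s_gt1.
apply: leq_trans (Gsq card_X); rewrite /edge_sum_in (bigD1 e) /= ?leq_addr //.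
by rewrite sub_eX card_e.
Qed.

Lemma sq_graph_prod_le : (edge_prod G <= q ^ 'C(#|V|, 2))%N.
Proof.
rewrite -cardsT -cards_draws -prod_nat_const /edge_prod /edge_prod_in.
under [leqRHS]eq_bigl do rewrite inE.
by apply: leq_prod => e /andP[_ /eqP]; apply: sq_graph_le.
Qed.

End SqGraph.

(** * The upper bound *)

Lemma light_vertex_exists (R : realType) (V : finType) (g : V -> V -> R)
    (lam Q : R) (l : seq V) (y : V -> R) : 0 <= lam -> 0 <= Q ->
    (forall u v, u != v -> g u v <= Q) ->
    l != [::] -> {in l, forall u, 0 < y u} ->
    (forall v, v \notin l ->
       \sum_(u <- l) y u * g u v <= lam * \sum_(u <- l) y u) ->
  exists u, \sum_(v | v != u) g u v <= lam * (#|V|%:R - 1) + (size l)%:R * Q.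
Proof.
move=> lam_ge0 Q_ge0 g_le l_neq0 y_gt0 light.
have Y_ge0 : 0 <= \sum_(u <- l) y u.
  by rewrite big_seq sumr_ge0 // => u /y_gt0/ltW.
have card_out : #|[predC l]|%:R <= #|V|%:R - 1 :> R.
  rewrite lerBrDr natr1 ler_nat -(cardC (mem l)) -add1n leq_add2r.
  apply/card_gt0P.
  by case: l l_neq0 {light y_gt0 Y_ge0} => // u l _; exists u; rewrite mem_head.
pose out u := \sum_(v | v \notin l) g u v.
have [|u u_l out_le] :=
  ler_sum_exists (F := out) (G := fun=> lam * (#|V|%:R - 1)) l_neq0 y_gt0.
  under eq_bigr do rewrite mulr_sumr.
  rewrite exchange_big /= -mulr_suml [leRHS]mulrCA [leRHS]mulrA.
  apply: le_trans (ler_sum _ (fun v (v_l : v \notin l) => light v v_l)) _.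
  by rewrite sumr_const -[_ *+ _]mulr_natr ler_wpM2l ?mulr_ge0.
exists u; rewrite (bigID (fun v => v \in l)) /= addrC lerD //.
  rewrite (eq_bigl (fun v => v \notin l)) // => v /=.
  by case: (eqVneq v u) => // ->; rewrite u_l.
apply: le_trans (_ : \sum_(v | (v != u) && (v \in l)) Q <= _).
  by apply: ler_sum => v /andP[vu _]; rewrite g_le // eq_sym.
rewrite sumr_const -[_ *+ _]mulr_natl ler_wpM2r // ler_nat.
apply: leq_trans (card_size l).
by apply/subset_leq_card/fintype.subsetP => v; rewrite unfold_in => /andP[].
Qed.

Section UpperBound.
Variables (R : realType) (r0 rd d s a : nat).
Hypotheses (r0_gt0 : (0 < r0)%N) (rd_gt0 : (0 < rd)%N) (d_gt0 : (0 < d)%N).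
Hypotheses (N_lt_s : (period r0 rd d < s)%N)
  (a_ge : (multiplicity_bound r0 rd d s <= a)%N).
Local Notation m := (list_bound r0 rd d s).
Local Notation rate := (log_rate R r0 rd d a).
Local Notation q := (Sigma_pat (turan_pattern (two_blocks r0 rd d) a) s).

Let d_lt_a : (d < a)%N. Proof. by case: (multiplicity_boundP a_ge). Qed.
Let rate_gt0 : 0 < rate.
Proof. by apply: log_rate_gt0 (leq_ltn_trans d_gt0 d_lt_a). Qed.
Let s_gt1 : (1 < s)%N.
Proof. exact: leq_ltn_trans (period_gt0 _ _ rd_gt0) N_lt_s. Qed.

Variables (V : finType) (G : multigraph V).
Hypotheses (s_le : (s <= #|V|)%N) (Gsq : sq_graph s q G)
  (G_gt0 : positive_graph G).
Implicit Types S : {set V}.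

Lemma ln_sq_graph_le (e : {set V}) : #|e| = 2%N -> ln (G e)%:R <= ln q%:R :> R.
Proof.
move=> card_e; have G_le := sq_graph_le s_gt1 s_le Gsq card_e.
by rewrite ler_ln ?posrE ?ltr0n ?ler_nat ?(leq_trans _ G_le) ?G_gt0.
Qed.

Lemma pair_sum_subset_le S (l : seq {x | x \in S}) : uniq l -> size l = s ->
  (pair_sum (fun u v => G [set val u; val v]) l +
     floor_sum (class_size d rd) (period r0 rd d) s <= a.+1 * 'C(s, 2))%N.
Proof.
move=> uniq_l size_l.
have uniq_val : uniq (map val l) by rewrite (map_inj_uniq val_inj).
apply: leq_trans (Sigma_turan_le d_gt0 (ltnW d_lt_a) r0_gt0 rd_gt0 s).
rewrite leq_add2r -(pair_sum_map val (fun u v => G [set u; v])).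
rewrite -edge_sum_in_seq //.
by apply: Gsq; rewrite cardsE (card_uniqP uniq_val) size_map.
Qed.

Lemma light_vertex_in S : S != finset.set0 -> exists2 u, u \in S &
  \sum_(v in S :\ u) ln (G [set v; u])%:R <=
    rate * (#|S|%:R - 1) + m%:R * ln q%:R.
Proof.
case/set0Pn=> x x_S; pose w (u v : {x | x \in S}) := G [set val u; val v].
have card_pair (u v : {x | x \in S}) : u != v -> #|[set val u; val v]| = 2%N.
  by move=> uv; rewrite cards2 (inj_eq val_inj) uv.
have wC u v : w u v = w v u by rewrite /w finset.setUC.
have w_gt0 u v : u != v -> (0 < w u v)%N by move/card_pair/G_gt0.
have [|l [y [/andP[l_gt0 size_l] y_gt0 light]]] :=
  light_list_exists R r0_gt0 rd_gt0 d_gt0 N_lt_s a_ge wC w_gt0 _ (Sub x x_S).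
  exact: pair_sum_subset_le.
have [||u] :=
  light_vertex_exists (ltW rate_gt0) (ln_nat_ge0 R q) _ _ y_gt0 light.
- by move=> u v /card_pair/ln_sq_graph_le.
- by rewrite -size_eq0 -lt0n.
rewrite card_sig => light_u; exists (val u); first exact: valP.
have sum_val : \sum_(v in S :\ val u) ln (G [set v; val u])%:R =
    \sum_(v | v != u) ln (w u v)%:R :> R.
  under eq_bigl do rewrite !inE andbC.
  rewrite (big_sub_cond (mem S) (fun v => v != val u)).
  by apply: eq_bigr => v _; rewrite wC.
rewrite sum_val (le_trans light_u) // lerD2l ler_wpM2r ?ln_nat_ge0 //.
by rewrite ler_nat.
Qed.

Lemma ln_edge_prod_in_le S :
  ln (edge_prod_in G S)%:R <= rate * 'C(#|S|, 2)%:R + m%:R * ln q%:R * #|S|%:R.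
Proof.
have [n] := ubnP #|S|; elim: n S => // n IHn S card_S.
have [->|S_neq0] := eqVneq S finset.set0.
  by rewrite ln_edge_prod_in0 // cards0 !mulr0 addr0.
have [u u_S light_u] := light_vertex_in S_neq0.
have u_Su : u \notin S :\ u by rewrite !inE eqxx.
have card_Su : #|S| = #|S :\ u|.+1 by rewrite (cardsD1 u S) u_S.
have {}IHn := IHn (S :\ u) _; rewrite -ltnS -card_Su in IHn.
rewrite -{1}(finset.setD1K u_S) ln_edge_prod_inU1 //.
apply: le_trans (lerD light_u (IHn card_S)) _.
rewrite card_Su binS bin1 natrD -[_.+1%:R]natr1; lra.
Qed.

End UpperBound.

(** * The lower bound *)

Section PatternLowerBound.
Variables (R : realType) (I : finType) (P : pattern I) (y : I -> R) (lam : R).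
Hypothesis P_gt0 : forall i j, (0 < P [set i; j])%N.

Lemma positive_blowup n (f : {ffun 'I_n -> I}) : positive_graph (blowup P f).
Proof. by move=> e /eqP/cards2P[u [v [_ ->]]]; rewrite blowupE. Qed.

Lemma edge_prod_in_blowup_eq n (f g : {ffun 'I_n -> I}) (S : {set 'I_n}) :
  {in S, f =1 g} -> edge_prod_in (blowup P f) S = edge_prod_in (blowup P g) S.
Proof.
move=> fg; apply: eq_bigr => e /andP[/fintype.subsetP sub_eS _]; congr (P _).
by apply: eq_in_imset => u /sub_eS/fg.
Qed.

Hypotheses (y_gt0 : forall i, 0 < y i) (I_gt0 : (0 < #|I|)%N).
Hypothesis log_degree_ge : forall j,
  lam * \sum_i y i <= \sum_i y i * ln (P [set j; i])%:R.

Lemma blowup_extend (V : finType) (S : {set V}) (f : V -> I) :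
  exists i, lam * #|S|%:R <= \sum_(u in S) ln (P [set f u; i])%:R.
Proof.
pose log_degree i : R := \sum_(u in S) ln (P [set f u; i])%:R.
have [|//||i _ i_le] :=
    @ler_sum_exists R I (index_enum I) y (fun=> lam * #|S|%:R) log_degree;
  last by exists i.
  by have /card_gt0P[i0 _] := I_gt0; case: (index_enum I) (mem_index_enum i0).
rewrite -mulr_suml; under [leRHS]eq_bigr do rewrite mulr_sumr.
rewrite exchange_big /= mulrCA mulrA mulr_natr -sumr_const.
by apply: ler_sum => u _; apply: log_degree_ge.
Qed.

Lemma ln_blowup_in_ge n (S : {set 'I_n}) : exists f : {ffun 'I_n -> I},
  lam * 'C(#|S|, 2)%:R <= ln (edge_prod_in (blowup P f) S)%:R.
Proof.
have /card_gt0P[i0 _] := I_gt0.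
have [k] := ubnP #|S|; elim: k S => // k IHk S card_S.
have [->|[v v_S]] := set_0Vmem S.
  by exists [ffun=> i0]; rewrite ln_edge_prod_in0 cards0 mulr0.
have card_Sv : #|S| = #|S :\ v|.+1 by rewrite (cardsD1 v S) v_S.
have v_Sv : v \notin S :\ v by rewrite !inE eqxx.
have [|f f_ge] := IHk (S :\ v); first by rewrite -ltnS -card_Sv.
have [i i_ge] := blowup_extend (S :\ v) f.
pose g := [ffun u => if u == v then i else f u].
have gf : {in S :\ v, g =1 f}.
  by move=> u; rewrite !inE ffunE => /andP[/negPf->].
have star_g : \sum_(u in S :\ v) ln (blowup P g [set u; v])%:R =
    \sum_(u in S :\ v) ln (P [set f u; i])%:R :> R.
  by apply: eq_bigr => u u_Sv; rewrite blowupE [g v]ffunE eqxx gf.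
exists g; rewrite -{2}(finset.setD1K v_S).
rewrite ln_edge_prod_inU1 ?star_g //; last exact: positive_blowup.
rewrite card_Sv binS bin1 natrD mulrDr addrC (edge_prod_in_blowup_eq gf).
exact: lerD.
Qed.

Lemma ln_Pi_pat_ge n : lam * 'C(n, 2)%:R <= ln (Pi_pat P n)%:R.
Proof.
have [f] := ln_blowup_in_ge [set: 'I_n].
rewrite cardsT card_ord => /le_trans; apply.
have prod_le : (edge_prod (blowup P f) <= Pi_pat P n)%N.
  exact: (leq_bigmax_cond (F := fun f => edge_prod (blowup P f))).
have prod_gt0 := edge_prod_in_gt0 (positive_blowup f) [set: 'I_n].
by rewrite ler_ln ?posrE ?ltr0n ?ler_nat // (leq_trans prod_gt0).
Qed.

End PatternLowerBound.

Section TuranLowerBound.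
Variables (R : realType) (r0 rd d a : nat).
Hypotheses (r0_gt0 : (0 < r0)%N) (rd_gt0 : (0 < rd)%N) (d_gt0 : (0 < d)%N).
Hypothesis d_lt_a : (d < a)%N.
Local Notation T := (turan_pattern (two_blocks r0 rd d) a).
Local Notation in_top := (@in_top r0 rd d).
Local Notation top := (top_weight R rd d a).
Local Notation low := (low_weight R a).
Local Notation rate := (log_rate R r0 rd d a).

Definition turan_weight (i : 'I_(sumn (two_blocks r0 rd d))) : R :=
  if in_top i then top else low.

Lemma turan_pattern_gt0 i j : (0 < T [set i; j])%N.
Proof.
have := turan_two_blocks d_gt0 (ltnW d_lt_a) i j; rewrite /defect.
by case: (i == j); case: (in_top i); case: (in_top j) => /=; lia.
Qed.

Lemma ln_turan_pattern i j :
  ln (T [set i; j])%:R = ln a.+1%:R - log_deficit R a (defect d in_top i j).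
Proof.
rewrite /log_deficit -(turan_two_blocks d_gt0 (ltnW d_lt_a) i j) addnK.
by rewrite opprB addrC subrK.
Qed.

Lemma turan_weight_gt0 i : 0 < turan_weight i.
Proof.
rewrite /turan_weight; case: ifP => _; first exact: top_weight_gt0.
exact: low_weight_gt0 d_lt_a.
Qed.

Lemma sum_turan_weight : \sum_i turan_weight i = r0%:R * top + rd%:R * low.
Proof.
rewrite (bigID in_top) /=.
rewrite -[in r0%:R](card_in_top r0 rd d) -[in rd%:R](card_notin_top r0 rd d).
rewrite !mulr_natl -!sumr_const; congr (_ + _); apply: eq_bigr => i.
  by rewrite /turan_weight => ->.
by rewrite /turan_weight => /negPf->.
Qed.

Lemma sum_turan_weight_log_deficit j :
  \sum_i turan_weight i * log_deficit R a (defect d in_top j i) = low * top.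
Proof.
have defect_neq i :
    i != j -> defect d in_top j i = (d * (~~ in_top j && ~~ in_top i))%N.
  by rewrite /defect eq_sym => /negPf->.
rewrite (bigD1 j) //= {1}/defect eqxx andbb /turan_weight.
have [top_j|low_j] := boolP (in_top j).
  rewrite big1 => [|i ij]; first by rewrite muln0 addn0 addr0 mulrC.
  by rewrite defect_neq // top_j muln0 log_deficit0 mulr0.
pose low_term i := if ~~ in_top i then low * log_deficit R a d else 0.
rewrite (eq_bigr low_term) => [|i ij]; last first.
  rewrite /low_term defect_neq // low_j; case: (in_top i); rewrite ?muln1 //.
  by rewrite muln0 log_deficit0 mulr0.
have card_others : #|[predD1 (predC in_top) & j]| = rd.-1.
  have := cardD1 j (predC in_top).
  by rewrite card_notin_top inE /= low_j => /(congr1 predn) ->.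
rewrite -big_mkcondr sumr_const.
rewrite (eq_card (B := [predD1 (predC in_top) & j])) => [|i]; last first.
  by rewrite !inE.
by rewrite card_others muln1 add1n /top_weight -(mulr_natl (low * _)); lra.
Qed.

Lemma ln_Pi_turan_ge n : rate * 'C(n, 2)%:R <= ln (Pi_pat T n)%:R.
Proof.
apply: ln_Pi_pat_ge turan_pattern_gt0 turan_weight_gt0 _ _ n => [|j].
  by rewrite card_ord sumn_two_blocks addn_gt0 r0_gt0.
under [leRHS]eq_bigr do rewrite ln_turan_pattern mulrBr.
rewrite sumrB -mulr_suml sum_turan_weight_log_deficit sum_turan_weight.
by rewrite /log_rate mulrBl (log_lossE R r0_gt0 rd_gt0 d_lt_a) mulrC.
Qed.

End TuranLowerBound.

(** * The extremal function *)

Lemma max_setP (A : classical_sets.set nat) m : (exists k, A k) ->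
  (forall k, A k -> (k <= m)%N) ->
  A (max_set A) /\ forall k, A k -> (k <= max_set A)%N.
Proof.
move=> [k0 Ak0] A_le.
have A_ex : exists k, `[< A k >] by exists k0; apply/asboolP.
have A_bounded k : `[< A k >] -> (k <= m)%N by move/asboolP/A_le.
case: (ex_maxnP A_ex A_bounded) => x /asboolP Ax x_max.
apply: (xgetPex 0%N (P := fun m => A m /\ forall k, A k -> (k <= m)%N)).
by exists x; split=> // k Ak; apply/x_max/asboolP.
Qed.

Lemma ex_Pi_max n s q : (1 < s <= n)%N ->
  (exists2 G : multigraph 'I_n, sq_graph s q G & edge_prod G = ex_Pi n s q) /\
  forall G : multigraph 'I_n, sq_graph s q G -> (edge_prod G <= ex_Pi n s q)%N.
Proof.
move=> /andP[s_gt1 s_le_n].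
pose values := fun m =>
  exists G : multigraph 'I_n, sq_graph s q G /\ edge_prod G = m.
have values_le k : values k -> (k <= q ^ 'C(n, 2))%N.
  case=> G [Gsq <-]; rewrite -[n in 'C(n, _)]card_ord.
  by apply: sq_graph_prod_le s_gt1 _ Gsq; rewrite card_ord.
pose zero : multigraph 'I_n := fun=> 0%N.
have zero_sq : sq_graph s q zero by move=> X _; rewrite /edge_sum_in big1.
have values_ex : exists k, values k by exists (edge_prod zero), zero.
have [[G [Gsq G_max]] max_ge] := max_setP values_ex values_le.
by split=> [|H Hsq]; [exists G | apply: max_ge; exists H].
Qed.

Lemma Pi_pat_le_ex_Pi (V : finType) (P : pattern V) n s : (1 < s <= n)%N ->
  (Pi_pat P n <= ex_Pi n s (Sigma_pat P s))%N.
Proof.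
move=> s_n; have [_ ex_ge] := ex_Pi_max (Sigma_pat P s) s_n.
by apply/bigmax_leqP => f _; apply/ex_ge/blowup_sq_graph.
Qed.

Import numFieldNormedType.Exports.
Local Open Scope classical_set_scope.
Local Open Scope ring_scope.

Lemma cvg_quadratic_ratio (R : realType) (x y : nat -> R) (lam K : R) s :
    0 < lam -> (forall n, (s <= n)%N -> lam * 'C(n, 2)%:R <= x n) ->
    (forall n, (s <= n)%N -> x n <= y n <= lam * 'C(n, 2)%:R + K * n%:R) ->
  y n / x n - 1 @[n --> \oo] --> (0 : R).
Proof.
move=> lam_gt0 x_ge y_le.
pose upper n := 6 * K / lam * harmonic n.
apply: (@squeeze_cvgr _ _ _ _ (fun=> 0) upper); last 2 first.
- exact: cvg_cst.
- rewrite -[X in _ --> X](mulr0 (6 * K / lam)).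
  by apply: cvgM; [exact: cvg_cst | exact: cvg_harmonic].
near=> n; have s_n : (s <= n)%N by near: n; apply: nbhs_infty_ge.
have n_ge2 : (2 <= n)%N by near: n; apply: nbhs_infty_ge.
have /andP[xy y_up] := y_le n s_n.
have n_ge2R : 2 <= n%:R :> R by rewrite ler_nat.
have bin_n : 2 * 'C(n, 2)%:R = n%:R * (n%:R - 1) :> R.
  by rewrite -natrM -mul_bin_diag bin1 natrM -subn1 natrB // ltnW.
have bin_gt0 : 0 < lam * 'C(n, 2)%:R by rewrite mulr_gt0 // ltr0n bin_gt0.
have x_gt0 := lt_le_trans bin_gt0 (x_ge n s_n).
have Kn_ge0 : 0 <= K * n%:R by have := x_ge n s_n; lra.
have K_ge0 : 0 <= K by rewrite pmulr_lge0 // in Kn_ge0; lra.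
have Kn_le : K * n%:R <= upper n * (lam * 'C(n, 2)%:R).
  have -> : upper n * (lam * 'C(n, 2)%:R) =
      K * (3 * (2 * 'C(n, 2)%:R)) / n.+1%:R.
    rewrite /upper /harmonic /=; field.
    by rewrite nat1r pnatr_eq0 (gt_eqF lam_gt0).
  rewrite ler_pdivlMr ?ltr0n // bin_n -natr1 -mulrA ler_wpM2l //.
  by rewrite mulrCA ler_wpM2l //; lra.
rewrite subr_ge0 ler_pdivlMr // mul1r xy /= lerBlDr ler_pdivrMr // mulrDl mul1r.
apply: le_trans y_up _; rewrite addrC lerD ?x_ge //; apply: le_trans Kn_le _.
rewrite ler_wpM2l ?x_ge // mulr_ge0 ?harmonic_ge0 //.
by rewrite divr_ge0 ?mulr_ge0 // ltW.
Unshelve. all: by end_near.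
Qed.

Section TuranExtremal.
Variables (R : realType) (r0 rd d s a : nat).
Hypotheses (r0_gt0 : (0 < r0)%N) (rd_gt0 : (0 < rd)%N) (d_gt0 : (0 < d)%N).
Hypotheses (N_lt_s : (period r0 rd d < s)%N)
  (a_ge : (multiplicity_bound r0 rd d s <= a)%N).
Local Notation T := (turan_pattern (two_blocks r0 rd d) a).
Local Notation q := (Sigma_pat T s).
Local Notation rate := (log_rate R r0 rd d a).

Let d_lt_a : (d < a)%N. Proof. by case: (multiplicity_boundP a_ge). Qed.
Let s_gt1 : (1 < s)%N.
Proof. exact: leq_ltn_trans (period_gt0 _ _ rd_gt0) N_lt_s. Qed.

Lemma turan_log_rate_gt0 : 0 < rate.
Proof. by apply: log_rate_gt0 (leq_ltn_trans d_gt0 d_lt_a). Qed.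

Lemma ln_Pi_turan_gt0 n : (s <= n)%N -> 0 < ln (Pi_pat T n)%:R :> R.
Proof.
move=> s_le_n.
apply: lt_le_trans (ln_Pi_turan_ge R r0_gt0 rd_gt0 d_gt0 d_lt_a n).
by rewrite mulr_gt0 ?turan_log_rate_gt0 // ltr0n bin_gt0 (leq_trans s_gt1).
Qed.

Lemma Pi_turan_gt0 n : (s <= n)%N -> (0 < Pi_pat T n)%N.
Proof.
by move=> /ln_Pi_turan_gt0; case: (Pi_pat T n) => //; rewrite ln0 ?ltxx.
Qed.

Lemma ex_Pi_turan_gt0 n : (s <= n)%N -> (0 < ex_Pi n s q)%N.
Proof.
move=> s_le_n; rewrite (leq_trans (Pi_turan_gt0 s_le_n)) //.
by rewrite Pi_pat_le_ex_Pi ?s_gt1.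
Qed.

Lemma ln_Pi_le_ln_ex_Pi n : (s <= n)%N ->
  ln (Pi_pat T n)%:R <= ln (ex_Pi n s q)%:R :> R.
Proof.
move=> s_le_n; rewrite ler_ln ?posrE ?ltr0n ?Pi_turan_gt0 ?ex_Pi_turan_gt0 //.
by rewrite ler_nat Pi_pat_le_ex_Pi ?s_gt1.
Qed.

Lemma ln_ex_Pi_le n : (s <= n)%N -> ln (ex_Pi n s q)%:R <=
  rate * 'C(n, 2)%:R + (list_bound r0 rd d s)%:R * ln q%:R * n%:R :> R.
Proof.
move=> s_le_n; have [|[G Gsq G_max] _] := @ex_Pi_max n s q.
  by rewrite s_gt1.
have G_gt0 : positive_graph G.
  move=> e card_e; have := ex_Pi_turan_gt0 s_le_n.
  rewrite -G_max /edge_prod /edge_prod_in (bigD1 e) /=.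
    by rewrite muln_gt0 => /andP[].
  by rewrite finset.subsetT card_e.
have ln_le := ln_edge_prod_in_le R r0_gt0 rd_gt0 d_gt0 N_lt_s a_ge _ Gsq G_gt0.
have := ln_le _ [set: 'I_n]%SET.
by rewrite -/(edge_prod G) G_max cardsT card_ord; apply.
Qed.

Definition ex_Pi_excess (n : nat) : R :=
  ln (ex_Pi n s q)%:R / ln (Pi_pat T n)%:R - 1.

Lemma ex_Pi_turanE n : (s <= n)%N ->
  (ex_Pi n s q)%:R = (Pi_pat T n)%:R `^ (1 + ex_Pi_excess n) :> R.
Proof.
move=> s_le_n; rewrite /powR pnatr_eq0 gtn_eqF ?Pi_turan_gt0 // addrC subrK.
by rewrite divfK ?gt_eqF ?ln_Pi_turan_gt0 // lnK // posrE ltr0n ex_Pi_turan_gt0.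
Qed.

Lemma cvg_ex_Pi_excess : ex_Pi_excess n @[n --> \oo] --> (0 : R).
Proof.
apply: (cvg_quadratic_ratio (s := s) turan_log_rate_gt0) => [n _|n s_le_n].
  exact: ln_Pi_turan_ge.
by rewrite ln_Pi_le_ln_ex_Pi //; apply: ln_ex_Pi_le.
Qed.

End TuranExtremal.

Theorem theorem1p15 (R : realType) (r0 rd d s : nat)
    (r0_gt0 : (0 < r0)%N) (rd_gt0 : (0 < rd)%N) (d_gt0 : (0 < d)%N)
    (s_ge : (r0 * (d * rd + 1) + rd + 1 <= s)%N) :
  let r : seq nat := r0 :: rcons (nseq d.-1 0%N) rd in
  exists a0 : nat, forall a : nat, (a0 <= a)%N ->
  let T := turan_pattern r a in
  exists eps : nat -> R,
    eps n @[n --> \oo] --> (0 : R) /\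
    forall n : nat, (s <= n)%N ->
      (ex_Pi n s (Sigma_pat T s))%:R = (Pi_pat T n)%:R `^ (1 + eps n).
Proof.
move=> r; exists (multiplicity_bound r0 rd d s) => a a_ge T.
have N_lt_s : (period r0 rd d < s)%N by move: s_ge; rewrite !addn1.
exists (ex_Pi_excess R r0 rd d s a); split; first exact: cvg_ex_Pi_excess.
by move=> n; apply: ex_Pi_turanE.
Qed.
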